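(* For $\nu\in\nu_0+\mathbb{N}$, $n\in\mathbb{N}$ and $t\in\mathbb{R}$, the matrix valued Hermite type polynomials satisfy $$\exp\bigl(-\tfrac t2A^\alpha\bigr)P_n^{(\alpha,\nu)}\bigl(x+\tfrac12t\bigr)\exp\bigl(\tfrac t2A^\alpha\bigr)=\bigl(M_n^{(\alpha,\nu)}(t)\bigr)^{-1}\sum_{k=0}^n\binom{n}{k}(-t)^k\bigl(G_{n-k}^{(\alpha,\nu+k)}\bigr)^{-1}P_{n-k}^{(\alpha,\nu+k)}(x)\left(\Phi^{(\alpha,\nu)}(x)\cdots\Phi^{(\alpha,\nu+k-1)}(x)\right)^\ast,$$ where $M_n^{(\alpha,\nu)}(t)$ is the (invertible, lower triangular) matrix $$M_n^{(\alpha,\nu)}(t)=\sum_{k=0}^n\binom{n}{k}t^k\Bigl(\prod_{p=0}^{k-1}d^{(\nu+p)}\Bigr)\bigl(G_{n-k}^{(\alpha,\nu+k)}\bigr)^{-1}(A^\alpha)^k.$$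
   Context: $N\ge1$ is an integer, $\mathbb{N}=\{0,1,2,\dots\}$. Scalars in matrix expressions denote multiples of the identity, $^\ast$ is the conjugate transpose, empty products are $1$ (or the identity). $H_n$ are the Hermite polynomials defined by $\sum_{n\ge0}\frac{t^n}{n!}H_n(x)=e^{2xt-t^2}$. $L(x)$ is the lower triangular $N\times N$ matrix with $L(x)_{m,n}=\frac{H_{m-n}(x)}{(m-n)!}$ for $m\ge n$ and $0$ for $m<n$, $m,n\in\{1,\dots,N\}$. $A=2\sum_{j=2}^NE_{j,j-1}$ with $E_{j,k}$ the matrix units. $\alpha_1,\dots,\alpha_N$ are non-zero real numbers with $\alpha_1=1$, $S^\alpha=\mathrm{diag}(\alpha_1,\dots,\alpha_N)$, $L^\alpha(x)=S^\alpha L(x)(S^\alpha)^{-1}$, $A^\alpha=S^\alpha A(S^\alpha)^{-1}$, $J=\mathrm{diag}(1,2,\dots,N)$. Fix $\nu_0$. For each $\nu\in\nu_0+\mathbb{N}$ let $\Delta^{(\nu)}=\mathrm{diag}(\delta_1^{(\nu)},\dots,\delta_N^{(\nu)})$ have positive diagonal entries and let $c^{(\nu)},d^{(\nu)}$ be positive reals. Standing assumptions: for all $\nu\in\nu_0+\mathbb{N}$, $$\Delta^{(\nu+1)}=(d^{(\nu)}J+c^{(\nu)})\Delta^{(\nu)},\qquad \frac{\alpha_{k+1}^2}{\alpha_k^2}=\frac{d^{(\nu)}k(N-k)}{2(d^{(\nu)}k+c^{(\nu)})}\frac{\delta_{k+1}^{(\nu)}}{\delta_k^{(\nu)}},\quad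 k=1,\dots,N-1.$$ The weight on $\mathbb{R}$ is $W^{(\alpha,\nu)}(x)=e^{-x^2}L^\alpha(x)\Delta^{(\nu)}L^\alpha(x)^\ast$, and $P_n^{(\alpha,\nu)}$ is the unique matrix polynomial of degree $n$ with leading coefficient the identity such that $\int_{\mathbb{R}}P_n^{(\alpha,\nu)}(x)W^{(\alpha,\nu)}(x)P_m^{(\alpha,\nu)}(x)^\ast dx=0$ for $n\neq m$. Further, $\Phi^{(\alpha,\nu)}(x)=W^{(\alpha,\nu)}(x)^{-1}W^{(\alpha,\nu+1)}(x)$, and $$G_n^{(\alpha,\nu)}=(K^{(\alpha,\nu)})^{-1}(K^{(\alpha,\nu+1)})^{-1}\cdots(K^{(\alpha,\nu+n-1)})^{-1},$$ where $K^{(\alpha,\nu)}=2\bigl(d^{(\nu)}(J-(N+1))-c^{(\nu)}\bigr)$ is the (diagonal, invertible) leading coefficient of the degree one matrix polynomial $\Psi^{(\alpha,\nu)}(x)=W^{(\alpha,\nu)}(x)^{-1}\frac{dW^{(\alpha,\nu+1)}}{dx}(x)$. *)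

(* Defs.v *)
From HB Require Import structures.
From mathcomp Require Import all_boot all_order all_algebra.
From mathcomp Require Import spectral.
From mathcomp Require Import all_classical all_reals all_analysis.
From mathcomp Require Import complex.

Set Implicit Arguments.
Unset Strict Implicit.
Unset Printing Implicit Defensive.

Import Order.TTheory GRing.Theory Num.Theory.
Import numFieldNormedType.Exports.

Local Open Scope classical_set_scope.
Local Open Scope complex_scope.
Local Open Scope sesquilinear_scope.
Local Open Scope ring_scope.

(* The size N >= 1 is [p.+1], so that square matrices form a ring; matrices   *)
(* have entries in the complex numbers R[i] over an arbitrary model R of the  *)
(* real numbers.  The real data alpha_k, delta_k^(nu) are functions of the    *)
(* index k in {1, ..., N}, whence the [i.+1] for i : 'I_p.+1.  All families   *)
(* depending on nu are functions on R of which only the values at             *)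
(* nu0, nu0 + 1, nu0 + 2, ... matter.                                         *)

Definition nu_range {R : realType} (nu0 nu : R) : Prop :=
  exists i : nat, nu = nu0 + i%:R.

(* The generating function determines H uniquely.                             *)
Definition is_hermite {R : realType} (H : nat -> {poly R}) : Prop :=
  forall x t : R,
    series (fun n => t ^+ n / n`!%:R * (H n).[x]) @ \oo
      --> expR (2 * x * t - t ^+ 2).

Definition mexp {K : numFieldType} {p : nat} (X : 'M[K]_p.+1) : 'M[K]_p.+1 :=
  lim (series (fun k => k`!%:R^-1 *: X ^+ k) @ \oo).

Section HermiteType.
Variables (R : realType) (p : nat).
Local Notation C := R[i].
Local Notation MC := 'M[R[i]]_p.+1.

Definition mintegral (F : R -> MC) : MC :=
  \matrix_(i, j)
    ((\int[lebesgue_measure]_(x in setT) complex.Re (F x i j))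
       +i* (\int[lebesgue_measure]_(x in setT) complex.Im (F x i j))).

(* P_n has matrix coefficients; evaluating at the central element x%:M makes  *)
(* the side on which [horner] multiplies irrelevant.                          *)
Definition mpeval (Q : {poly MC}) (x : R) : MC := Q.[(x%:C)%:M].

Definition is_mop (W : R -> MC) (P : nat -> {poly MC}) : Prop :=
  (forall n, size (P n) = n.+1 /\ lead_coef (P n) = 1) /\
  (forall n m, n <> m ->
     mintegral (fun x => mpeval (P n) x * W x * (mpeval (P m) x)^t*) = 0).

Definition dgmx (a : nat -> R) : MC := diag_mx (\row_i (a i.+1)%:C).

Definition Jmx : MC := dgmx (fun k => k%:R).

Definition Amx : MC := \matrix_(i, j) (if i == j.+1 :> nat then 2 else 0).

Definition Lmx (H : nat -> {poly R}) (x : R) : MC :=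
  \matrix_(i, j)
    (if (j <= i)%N then ((H (i - j)%N).[x] / (i - j)%N`!%:R)%:C else 0).

Definition Aal (alpha : nat -> R) : MC := dgmx alpha * Amx * (dgmx alpha)^-1.

Definition Lal (H : nat -> {poly R}) (alpha : nat -> R) (x : R) : MC :=
  dgmx alpha * Lmx H x * (dgmx alpha)^-1.

Definition weight (H : nat -> {poly R}) (alpha : nat -> R)
    (delta : R -> nat -> R) (nu x : R) : MC :=
  (expR (- x ^+ 2))%:C *:
    (Lal H alpha x * dgmx (delta nu) * (Lal H alpha x)^t*).

Definition Phi (H : nat -> {poly R}) (alpha : nat -> R)
    (delta : R -> nat -> R) (nu x : R) : MC :=
  (weight H alpha delta nu x)^-1 * weight H alpha delta (nu + 1) x.

(* Closed formula for the leading coefficient of the degree one polynomial    *)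
(* (weight nu)^-1 * (weight (nu + 1))'; [p.+1.+1] is N + 1.                   *)
Definition Kmx (c d : R -> R) (nu : R) : MC :=
  2 *: ((d nu)%:C *: (Jmx - (p.+1.+1%:R)%:M) - ((c nu)%:C)%:M).

Definition Gmx (c d : R -> R) (nu : R) (n : nat) : MC :=
  \prod_(j < n) (Kmx c d (nu + j%:R))^-1.

Definition Mmx (alpha : nat -> R) (c d : R -> R) (nu : R) (n : nat) (t : R) :
    MC :=
  \sum_(k < n.+1)
    (('C(n, k)%:R * t ^+ k * \prod_(q < k) d (nu + q%:R))%:C
       *: ((Gmx c d (nu + k%:R) (n - k))^-1 * Aal alpha ^+ k)).

Definition standing (alpha : nat -> R) (nu0 : R) (delta : R -> nat -> R)
    (c d : R -> R) : Prop :=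
  forall nu, nu_range nu0 nu ->
    [/\ forall k, (1 <= k <= p.+1)%N -> 0 < delta nu k,
        0 < c nu, 0 < d nu,
        dgmx (delta (nu + 1))
          = ((d nu)%:C *: Jmx + ((c nu)%:C)%:M) * dgmx (delta nu)
      & forall k, (1 <= k <= p)%N ->
          alpha k.+1 ^+ 2 / alpha k ^+ 2
            = d nu * k%:R * (p.+1%:R - k%:R) / (2 * (d nu * k%:R + c nu))
              * (delta nu k.+1 / delta nu k)].

End HermiteType.

Arguments Amx R p : clear implicits.
Arguments Jmx R p : clear implicits.

(* Main.v *)
Require Import Defs.
From mathcomp Require Import all_boot all_order all_algebra.
From mathcomp Require Import spectral.
From mathcomp Require Import all_classical all_reals all_analysis.
From mathcomp Require Import measurable_realfun.
From mathcomp Require Import complex ring lra.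

(** Write A, J and L(x) for [Aal p alpha], [Jmx R p] and [Lal p H alpha x],
    and let s = t/2.

    The weight under translation.  A is nilpotent and L(x) is the value at A of
    the generating series exp(x X - X^2/4) of the scaled Hermite polynomials.
    Hence L(x + s) = exp(s A) L(x) ([Lal_shift]), and translating the weight by
    s multiplies it by exp(-2 s x - s^2), by exp(s A) on the left and by the
    adjoint of exp(s A) on the right.

    The Rodrigues formula.  J acts on polynomials in A as the derivation
    X d/dX, and the standing assumptions make A and a conjugate of its adjoint
    into two opposite root vectors of an sl2 whose Cartan element is an affine
    function of J ([Delta_ctA], [Bmx_Aal]).  Conjugating by L(x) then shows that
    W_(nu+1) W_nu^-1 and W_(nu+1)' W_nu^-1 are polynomials of degree one in x
    ([Phip_Vpoly], [Psip_Vpoly]), the second with leading coefficient K_nu.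
    By iteration the n-th derivative of W_(nu+n) is R_n W_nu for a polynomial
    R_n of degree n with leading coefficient G_n^-1.  Integration by parts makes
    R_n orthogonal to all polynomials of smaller degree, and the positivity of
    the weight makes such a polynomial unique up to a left factor, so that
    P_n = G_n R_n ([mop_rodrigues]).

    The expansion.  Translate the Rodrigues formula by s.  The factor
    exp(-2 s x) coming from the Gaussian produces, by the Leibniz rule, the
    terms binomial(n, k) (-t)^k times the (n-k)-th derivative of W_(nu+n), and
    each of these is R_(n-k) W_(nu+k) by the Rodrigues formula at nu + k
    ([rodrigues_poly_shift]).  This is the sum on the right-hand side, with
    exp(-s A) G_n exp(s A) in front of it.

    The prefactor.  Conjugation by exp(s A) maps J to J + s A, hence each K_j to
    K_j + t d_j A.  The relation d_(j+1) A K_j = d_j K_(j+1) A, which compares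
    the standing assumptions at nu + j and nu + j + 1, moves all factors A to
    the right, and Pascal's rule turns the product of the K_j + t d_j A into
    M_n ([MseqS], [MseqE]).

    All functions that occur are a matrix polynomial times exp(-x^2).  They are
    represented by that polynomial Q, the derivative by [gaussderiv Q] and the
    integral over the line by the combination [gaussint Q] of the coefficients
    of Q, so that analysis enters only through the moments of the Gaussian and
    through the recurrence of the Hermite polynomials. *)

Set Implicit Arguments.
Unset Strict Implicit.
Unset Printing Implicit Defensive.

Import Order.TTheory GRing.Theory Num.Theory.
Import numFieldNormedType.Exports.

Local Open Scope classical_set_scope.
Local Open Scope complex_scope.
Local Open Scope sesquilinear_scope.
Local Open Scope ring_scope.

(** * Uniqueness of the coefficients of a power series *)

Section PowerSeries.
Variable R : realType.
Implicit Types (f : R ^nat) (x : R).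

Definition entire f := forall x, cvgn (pseries f x).

(** Since n <= 2^n, the differentiated series at x is dominated by the tail of
    the original one at 2 (|x| + 1). *)
Lemma entire_diffs f : entire f -> entire (pseries_diffs f).
Proof.
move=> fe x; pose y := 2 * (`|x| + 1).
have y_gt0 : 0 < y by rewrite mulr_gt0// ltr_wpDl.
have yn : `|y| < `|y + 1| by rewrite !gtr0_norm ?ltrDl// addr_gt0.
have := is_cvg_pseries_inside_norm (fe (y + 1)) yn.
move=> cy; apply: normed_cvg.
have cy1 : cvgn (series (fun n => `|f n.+1| * y ^+ n.+1)).
  rewrite (_ : series _ = (fun n => pseries (fun i => `|f i|) y n.+1 - `|f 0%N|)); last first.
    by apply/funext => n; rewrite /pseries /series /= big_nat_recl// expr0 mulr1 addrC addKr.
  apply: is_cvgB; last exact: is_cvg_cst.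
  by have /cvg_ex[l cl] := cy; apply/cvg_ex; exists l; rewrite cvg_shiftS.
apply: series_le_cvg cy1 => [n|n|n] /=; [by []|by rewrite mulr_ge0// exprn_ge0// ltW|].
rewrite /pseries_diffs normrM normrM normrX ger0_norm// mulrAC mulrC.
rewrite [in leRHS]/y exprMn ler_wpM2l// ler_pM ?exprn_ge0//.
  by rewrite -natrX ler_nat ltnW// ltn_expl.
apply: (@le_trans _ _ ((`|x| + 1) ^+ n)); first by rewrite lerXn2r ?nnegrE ?addr_ge0// lerDl.
by rewrite exprS ler_peMl ?exprn_ge0 ?addr_ge0// lerDr.
Unshelve. all: by end_near. Qed.

Lemma is_derive_pseries f x : entire f ->
  is_derive x 1 (fun y => limn (pseries f y)) (limn (pseries (pseries_diffs f) x)).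
Proof.
move=> fe; have dfe := entire_diffs fe; have ddfe := entire_diffs dfe.
apply: (@pseries_snd_diffs _ f (`|x| + 1)); [exact: fe|exact: dfe|exact: ddfe|].
by rewrite [ltRHS]ger0_norm ?ltrDl// addr_ge0.
Qed.

Lemma limn_pseries0 f : limn (pseries f 0) = f 0%N.
Proof.
apply: lim_near_cst => //; near=> n.
have -> : n = n.-1.+1 by rewrite prednK//; near: n; exists 1%N.
rewrite /pseries /series /= big_nat_recl// big1 ?addr0 ?expr0 ?mulr1//.
by move=> i _; rewrite expr0n mulr0.
Unshelve. all: by end_near. Qed.

(** The value at 0 is the first coefficient, and differentiating term by term
    brings the next coefficient to that place. *)
Lemma pseries_eq0 f : (forall x, pseries f x @ \oo --> 0) -> forall n, f n = 0.
Proof.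
move=> f0 n; elim: n f f0 => [|n IH] f f0.
  by rewrite -limn_pseries0; apply/cvg_lim => //; exact: f0.
have fe : entire f by move=> x; apply/cvg_ex; exists 0; exact: f0.
have diff0 x : pseries (pseries_diffs f) x @ \oo --> 0.
  suff <- : limn (pseries (pseries_diffs f) x) = 0 by exact: entire_diffs.
  have -> : limn (pseries (pseries_diffs f) x) = 'D_1 (fun y => limn (pseries f y)) x.
    by apply/esym; apply: derive_val; exact: is_derive_pseries.
  rewrite (_ : (fun y => _) = cst 0) ?derive_cst//.
  by apply/funext => y; apply/cvg_lim => //; exact: f0.
by have /eqP := IH _ diff0; rewrite mulf_eq0 pnatr_eq0 /= => /eqP.
Qed.

End PowerSeries.

(** * Hermite polynomials from their generating function *)

Section Hermite.
Variable R : realType.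

Lemma poly_nat_eq0 (K : numDomainType) (q : {poly K}) :
  (forall n : nat, q.[n%:R] = 0) -> q = 0.
Proof.
move=> q0; pose rs : seq K := [seq n%:R | n <- iota 0 (size q)].
apply: (@roots_geq_poly_eq0 _ q rs); last by rewrite size_map size_iota.
  by apply/allP => _ /mapP[n _ ->]; apply/eqP; exact: q0.
by rewrite map_inj_uniq ?iota_uniq//; exact: mulrIn (oner_neq0 _).
Qed.

Lemma poly_ext (q1 q2 : {poly R}) : (forall x, q1.[x] = q2.[x]) -> q1 = q2.
Proof.
move=> q12; apply/eqP; rewrite -subr_eq0; apply/eqP/poly_nat_eq0 => n.
by rewrite hornerD hornerN q12 subrr.
Qed.

Variable H : nat -> {poly R}.
Hypothesis hH : is_hermite H.

Let a x n := (H n).[x] / n`!%:R.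

Let a_cvg x t : pseries (a x) t @ \oo --> expR (2 * x * t - t ^+ 2).
Proof.
rewrite (_ : pseries _ _ = series (fun n => t ^+ n / n`!%:R * (H n).[x])).
  by have := hH; rewrite /is_hermite => /(_ x t); apply.
by congr series; apply/funext => n; rewrite /a /=; ring.
Qed.

Lemma pseries_shift (f : R ^nat) (t l : R) : pseries f t @ \oo --> l ->
  pseries (fun n => if n is m.+1 then f m else 0) t @ \oo --> t * l.
Proof.
move=> fl; rewrite -cvg_shiftS.
rewrite (_ : (fun n => _) = (fun n => t * pseries f t n)); first exact: cvgMr.
apply/funext => n; rewrite /pseries /series /= big_nat_recl// mul0r add0r.
by rewrite big_distrr /=; apply: eq_bigr => i _; rewrite exprS mulrCA.
Qed.

Lemma hermite0 : H 0%N = 1.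
Proof.
apply: poly_ext => x.
have /(cvg_lim (@Rhausdorff R)) := @a_cvg x 0.
by rewrite limn_pseries0 /a fact0 divr1 expr0n mulr0 subr0 expR0 hornerC.
Qed.

(** As a function of t the generating function y satisfies y' = (2x - 2t) y;
    the recurrence compares the coefficients of both sides. *)
Let a_rec x n :
  n.+1%:R * a x n.+1 = 2 * x * a x n - 2 * (if n is m.+1 then a x m else 0).
Proof.
apply/eqP; rewrite -subr_eq0; apply/eqP.
pose b n := n.+1%:R * a x n.+1 -
  (2 * x * a x n - 2 * (if n is m.+1 then a x m else 0)).
rewrite -[LHS]/(b n); move: n; apply: pseries_eq0 => t.
have ae : entire (a x) by move=> s; apply/cvg_ex; eexists; exact: a_cvg.
pose f s := expR (2 * x * s - s ^+ 2).
have fE s : limn (pseries (a x) s) = f s by apply/cvg_lim => //; exact: a_cvg.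
have df : is_derive t 1 f ((2 * x - 2 * t) * f t).
  rewrite /f; apply: is_derive_eq.
  by rewrite /GRing.scale /=; ring.
have diffE : limn (pseries (pseries_diffs (a x)) t) = (2 * x - 2 * t) * f t.
  rewrite -(@derive_val _ _ _ _ _ _ _ df) -(_ : (fun s => limn (pseries (a x) s)) = f).
    by apply/esym/derive_val; exact: is_derive_pseries.
  exact/funext.
have cb : pseries b t @ \oo -->
    limn (pseries (pseries_diffs (a x)) t) - (2 * x * f t - 2 * (t * f t)).
  rewrite (_ : pseries b t = (fun n => pseries (pseries_diffs (a x)) t n
     - (2 * x * pseries (a x) t n
        - 2 * pseries (fun n => if n is m.+1 then a x m else 0) t n))).
    apply: cvgB; first exact: entire_diffs.
    by apply: cvgB; apply: cvgMr; [exact: a_cvg|apply: pseries_shift; exact: a_cvg].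
  apply/funext => n; rewrite /pseries /series /= !big_distrr -!sumrB /=.
  by apply: eq_bigr => i _; rewrite /b /pseries_diffs !mulrBl !mulrA.
suff <- : limn (pseries (pseries_diffs (a x)) t) - (2 * x * f t - 2 * (t * f t)) = 0.
  exact: cb.
by rewrite diffE; ring.
Qed.

(** With this scaling the generating series is exp(x X - X^2/4), whose
    X-coefficients are those of L(x) as a polynomial in A: the factor 2^n is
    the n-th power of the 2 in A. *)
Definition scaled_hermite n : {poly R} := (2 ^+ n * n`!%:R)^-1 *: H n.
Local Notation u := scaled_hermite.

Let uE n x : (u n).[x] = a x n / 2 ^+ n.
Proof. by rewrite hornerZ invfM /a mulrC mulrCA mulrC -mulrA mulrC. Qed.

Lemma scaled_hermite0 : u 0%N = 1.
Proof. by rewrite /u hermite0 expr0 mul1r fact0 invr1 scale1r. Qed.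

Lemma scaled_hermite1 : u 1%N = 'X.
Proof.
apply: poly_ext => x; rewrite uE hornerX.
have := a_rec x 0; rewrite mul1r mulr0 subr0 => ->.
by rewrite {1}/a hermite0 hornerC fact0 divr1 mulr1 expr1 mulrC mulKf.
Qed.

Lemma scaled_hermite_rec n :
  n.+2%:R *: u n.+2 = 'X * u n.+1 - 2^-1 *: u n.
Proof.
apply: poly_ext => x; rewrite hornerD hornerN (hornerZ n.+2%:R (u _)) (hornerZ 2^-1 (u _)) hornerM hornerX !uE.
rewrite [n.+2%:R * _]mulrA a_rec !exprS.
have : (2 : R) ^+ n != 0 by rewrite expf_neq0.
move: (2 ^+ n) => e e0; field; exact: e0.
Qed.

Lemma deriv_scaled_hermite n : (u n.+1)^`() = u n.
Proof.
elim/ltn_ind: n => -[|n] IH.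
  by rewrite scaled_hermite1 derivX scaled_hermite0.
have E : n.+2%:R *: (u n.+2)^`() = n.+2%:R *: u n.+1.
  rewrite -(derivZ n.+2%:R (u _)) scaled_hermite_rec derivB derivM derivX mul1r.
    rewrite (derivZ 2^-1 (u _)) IH//.
  case: n IH => [|n] IH.
    by rewrite scaled_hermite0 derivC scaler0 subr0 scaled_hermite1 mulr1 -mulr2n scaler_nat.
  by rewrite IH// -addrA -scaled_hermite_rec -(nat1r n.+2) scalerDl scale1r.
by apply: scalerI E; rewrite pnatr_eq0.
Qed.

Lemma size_scaled_hermite n : (size (u n) <= n.+1)%N.
Proof.
elim/ltn_ind: n => -[|[|n]] IH.
- by rewrite scaled_hermite0 size_poly1.
- by rewrite scaled_hermite1 size_polyX.
rewrite -(@size_scale _ n.+2%:R (u _)) ?pnatr_eq0// scaled_hermite_rec.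
have un : (size (2^-1 *: u n) <= size (u n))%N := size_scale_leq _ _.
apply: leq_trans (size_polyD _ _) _; rewrite geq_max size_polyN; apply/andP; split.
  by apply: leq_trans (size_polyMleq _ _) _; rewrite size_polyX ltnS IH.
by apply: leq_trans un _; apply: leq_trans (IH n _) _; rewrite // ltnW.
Qed.

Lemma nderivn_scaled_hermite n k :
  (k <= n)%N -> (u n)^`N(k) = k`!%:R^-1 *: u (n - k).
Proof.
move=> kn; apply: (@scalerI _ _ (k`!%:R : R)); first by rewrite pnatr_eq0 -lt0n fact_gt0.
rewrite scalerA divff ?scale1r; last by rewrite pnatr_eq0 -lt0n fact_gt0.
rewrite scaler_nat -nderivn_def; elim: k kn => [|k IH] kn; first by rewrite derivn0 subn0.
by rewrite derivnS IH 1?ltnW// -(subnSK kn) deriv_scaled_hermite.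
Qed.

(** Taylor's formula: the k-th derivative of [u n] is [u (n - k)]. *)
Lemma scaled_hermite_shift n x s :
  (u n).[x + s] = \sum_(k < n.+1) s ^+ k / k`!%:R * (u (n - k)).[x].
Proof.
rewrite (@nderiv_taylor_wide _ n.+1 (u n)) ?size_scaled_hermite//; last exact: mulrC.
apply: eq_bigr => k _; rewrite nderivn_scaled_hermite -1?ltnS// (hornerZ _ (u _)).
by rewrite mulrC mulrA.
Qed.

End Hermite.

(** * Integrals of polynomials against the Gaussian *)

Section GaussianMoments.
Variable R : realType.
Local Notation mu := (@lebesgue_measure R).
Implicit Types (q : {poly R}) (x : R).

(** One half of the exponent absorbs any power of x, because the exponential
    series of x^2/2 dominates its (k+1)-st term. *)
Lemma exprn_half_gauss_le k : exists C : R, 0 <= C /\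
  forall x, `|x| ^+ k * expR (- x ^+ 2) <= C * expR (- x ^+ 2 / 2).
Proof.
pose D : R := 2 ^+ k.+1 * k.+1`!%:R.
exists (1 + D); split; first by rewrite addr_ge0// mulr_ge0.
move=> x; have -> : expR (- x ^+ 2) = expR (- x ^+ 2 / 2) * expR (- x ^+ 2 / 2).
  by rewrite -expRD; congr expR; field.
rewrite mulrA ler_wpM2r ?expR_ge0// mulNr expRN ler_pdivrMr ?expR_gt0//.
have y0 : 0 <= x ^+ 2 / 2 by rewrite divr_ge0// sqr_ge0.
have yD : (x ^+ 2) ^+ k.+1 <= D * expR (x ^+ 2 / 2).
  have -> : (x ^+ 2) ^+ k.+1 = D * ((x ^+ 2 / 2) ^+ k.+1 / k.+1`!%:R).
    rewrite /D expr_div_n; field.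
    by rewrite pnatr_eq0 -lt0n fact_gt0 expf_neq0.
  rewrite ler_wpM2l ?mulr_ge0 ?exprn_ge0//.
  by apply: le_trans (expR_ge1Dxn k y0); rewrite ler_wpDl.
have e1 : 1 <= expR (x ^+ 2 / 2) by rewrite -[leLHS]expR0 ler_expR.
rewrite mulrDl mul1r; have [x1|x1] := leP `|x| 1.
  apply: (@le_trans _ _ 1); first exact: exprn_ile1.
  by rewrite (le_trans e1)// lerDl (le_trans _ yD)// exprn_ge0// sqr_ge0.
apply: (@le_trans _ _ ((x ^+ 2) ^+ k.+1)); last by rewrite (le_trans yD)// lerDr expR_ge0.
rewrite -[x ^+ 2]ger0_norm ?sqr_ge0// normrX -exprM ler_weXn2l// ?ltW//.
by rewrite mul2n -addnn (leq_trans (leqnSn _))// leq_addr.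
Qed.

Lemma integrable_half_gauss : mu.-integrable setT (EFin \o (fun x => expR (- x ^+ 2 / 2))).
Proof.
have i1 := @integrable_normal_pdf R 0 1.
have := integrableZl measurableT (normal_peak (1 : R))^-1 i1.
apply: eq_integrable => // x _ /=.
rewrite -EFinM normal_pdfE ?oner_eq0//= mulKf ?gt_eqF ?normal_peak_gt0 ?oner_eq0//.
by rewrite /normal_fun subr0 expr1n.
Qed.

Definition gaussian_term k x : R := x ^+ k * expR (- x ^+ 2).

Lemma continuous_gaussian_term k : continuous (gaussian_term k).
Proof.
move=> x; apply: cvgM; first exact: exprn_continuous.
exact: continuous_gauss_fun.
Qed.

Lemma integrable_gaussian_term k : mu.-integrable setT (EFin \o gaussian_term k).
Proof.
have [C [C0 Ck]] := exprn_half_gauss_le k.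
have := integrableZl measurableT C integrable_half_gauss.
apply: le_integrable => //.
  apply/measurable_EFinP; apply: (@continuous_measurable_fun _ (gaussian_term k)).
  exact: continuous_gaussian_term.
move=> x _ /=; rewrite lee_fin normrM normrX (ger0_norm (expR_ge0 _)).
by rewrite (le_trans (Ck x))// ler_norm.
Qed.

Definition gauss_moment k : R := \int[mu]_(x in setT) gaussian_term k x.

Lemma integrable_gaussian_poly q :
  mu.-integrable setT (EFin \o (fun x => q.[x] * expR (- x ^+ 2))).
Proof.
have : mu.-integrable setT (fun x => \sum_(k < size q) (q`_k)%:E * (gaussian_term k x)%:E)%E.
  apply: integrable_sum => // k _; apply: integrableZl => //.
  exact: integrable_gaussian_term.
apply: eq_integrable => // x _ /=.
rewrite horner_coef big_distrl -sumEFin; apply: eq_bigr => k _.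
by rewrite -EFinM mulrA.
Qed.

Lemma integral_gaussian_poly q :
  \int[mu]_(x in setT) (q.[x] * expR (- x ^+ 2)) = \sum_(k < size q) q`_k * gauss_moment k.
Proof.
rewrite /Rintegral.
have -> : (\int[mu]_(x in setT) (q.[x] * expR (- x ^+ 2))%:E =
    \int[mu]_(x in setT) \sum_(k < size q) (q`_k)%:E * (gaussian_term k x)%:E)%E.
  apply: eq_integral => x _; rewrite horner_coef big_distrl -sumEFin.
  by apply: eq_bigr => k _; rewrite -EFinM mulrA.
rewrite integral_sum//=; last first.
  by move=> k; apply: integrableZl => //; exact: integrable_gaussian_term.
have E k : (\int[mu]_x (gaussian_term k x)%:E)%E = (gauss_moment k)%:E.
  rewrite /gauss_moment /Rintegral fineK//.
  by apply: integrable_fin_num => //; exact: integrable_gaussian_term.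
under eq_bigr => k _.
  rewrite integralZl//; last exact: integrable_gaussian_term.
  rewrite E -EFinM; over.
by rewrite sumEFin.
Qed.

(** The integrand vanishes almost everywhere, and a non-zero polynomial has
    finitely many roots: the line would be the union of two null sets. *)
Lemma gaussian_poly_eq0 q : (forall x, 0 <= q.[x]) ->
  \int[mu]_(x in setT) (q.[x] * expR (- x ^+ 2)) = 0 -> q = 0.
Proof.
move=> q0 iq; apply/eqP/negPn/negP => qn0.
have iqE : (\int[mu]_(x in setT) `| (q.[x] * expR (- x ^+ 2))%:E | = 0)%E.
  rewrite -[RHS]/(0%:E) -iq /Rintegral fineK; last first.
    by apply: integrable_fin_num => //; exact: integrable_gaussian_poly.
  by apply: eq_integral => x _; rewrite gee0_abs// lee_fin mulr_ge0// expR_ge0.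
have [+ _] := ae_eq_integral_abs mu measurableT
  (measurable_int mu (integrable_gaussian_poly q)).
move=> /(_ iqE) h.
have : mu.-negligible [set x | q.[x] != 0].
  apply: negligibleS h => x /= qx /(_ I) /eqP.
  by rewrite eqe mulf_eq0 expR_eq0 orbF; apply/negP.
have : mu.-negligible [set x | q.[x] = 0].
  pose rs := [set x | q.[x] = 0].
  have fin : finite_set rs.
    have [n] := ubnP (size q); elim: n q qn0 @rs {q0 iq iqE h} => // n IH q qn0 rs sq.
    have [[x qx]|no] := pselect (exists x, q.[x] = 0); last first.
      by rewrite (_ : rs = set0)//; apply/seteqP; split => // x qx; apply: no; exists x.
    have /factor_theorem[r qE] : root q x by apply/eqP.
    have rn0 : r != 0 by apply: contraNneq qn0 => r0; rewrite qE r0 mul0r.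
    apply: (@sub_finite_set _ _ ([set y | r.[y] = 0] `|` [set x])).
      move=> y; rewrite /rs /= qE hornerM !hornerE => /eqP.
      by rewrite mulf_eq0 subr_eq0 => /orP[/eqP|/eqP]; [left|right].
    rewrite finite_setU; split; last exact: finite_set1.
    by apply: IH => //; move: sq; rewrite qE size_Mmonic ?monicXsubC// size_XsubC addn2.
  apply/negligibleP; first exact/countable_measurable/finite_set_countable.
  exact/countable_lebesgue_measure0/finite_set_countable.
move=> n1 n2; have := negligibleU n1 n2.
rewrite (_ : _ `|` _ = setT); last first.
  by apply/seteqP; split => // x _ /=; case: (eqVneq q.[x] 0); [left|right].
move=> /(negligibleP _ measurableT).
have muT : mu setT = +oo%E by rewrite -set_itvNyy lebesgue_measure_itv.
by have := muT; move=> /[swap] ->.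
Qed.

(** Both sides differ by the integral of the derivative of x^k exp(-x^2).  On
    [-(n+1), n+1] that integral is a boundary term, which tends to 0; dominated
    convergence passes to the whole line. *)
Lemma gauss_moment_rec k : k%:R * gauss_moment k.-1 = 2 * gauss_moment k.+1.
Proof.
pose f x : R := k%:R * gaussian_term k.-1 x - 2 * gaussian_term k.+1 x.
have cf : continuous f.
  by move=> x; apply: cvgB; apply: cvgMr; exact: continuous_gaussian_term.
have if_ : mu.-integrable setT (EFin \o f).
  have i1 := integrableZl measurableT k%:R (integrable_gaussian_term k.-1).
  have i2 := integrableZl measurableT 2 (integrable_gaussian_term k.+1).
  by have := integrableB measurableT i1 i2; apply: eq_integrable.
have df (x : R) : is_derive x 1 (gaussian_term k) (f x).
  have dk : is_derive x 1 (fun y : R => y ^+ k) (k%:R * x ^+ k.-1).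
    rewrite (_ : (fun y => _) = id ^+ k); last by apply/funext => y; rewrite exprfctE.
    by apply: is_derive_eq; rewrite /GRing.scale /= mulr1.
  rewrite /gaussian_term; apply: is_derive_eq.
  rewrite /f /gaussian_term /GRing.scale /= [x ^+ k.+1]exprS.
  by move: (x ^+ k) (x ^+ k.-1) (k%:R : R) => a b e; ring.
suff : \int[mu]_(x in setT) f x = 0.
  rewrite /f RintegralB//; [|exact: integrableZl (integrable_gaussian_term _)..].
  rewrite !RintegralZl//; [|exact: integrable_gaussian_term..].
  by move/eqP; rewrite subr_eq0 => /eqP.
pose I n := `[- (n.+1%:R : R), n.+1%:R]%classic.
pose f_ n := (EFin \o f) \_ (I n).
have mI n : measurable (I n) by exact: measurable_itv.
have mf : measurable_fun setT (EFin \o f).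
  by apply/measurable_EFinP; apply: (@continuous_measurable_fun _ f).
have mf_ n : measurable_fun setT (f_ n).
  by apply/(measurable_restrictT _ (mI n)); exact: measurable_funTS.
have cvf : {ae mu, forall x, setT x -> f_ ^~ x @ \oo --> (EFin \o f) x}.
  apply: aeW => x _; apply: cvg_near_cst; near=> n.
  rewrite /f_ patchE ifT// inE /I /= in_itv /= -ler_norml.
  apply/ltW/(@lt_le_trans _ _ (Num.truncn `|x|).+1%:R); first exact: truncnS_gt.
  by rewrite ler_nat ltnS; near: n; exact: nbhs_infty_ge.
have bdf : {ae mu, forall x n, setT x -> (`|f_ n x| <= `|(EFin \o f) x|)%E}.
  apply: aeW => x n _; rewrite /f_ patchE; case: ifPn => // _.
  by rewrite abse0.
have [_ _ cv] := @dominated_convergence _ _ R mu setT measurableT f_ (EFin \o f)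
  (fun x => `|(EFin \o f) x|%E) mf_ mf cvf (integrable_abse if_) bdf.
have int_f n : (\int[mu]_x f_ n x = (gaussian_term k n.+1%:R - gaussian_term k (- n.+1%:R))%:E)%E.
  rewrite /f_ -integral_mkcond /= (@continuous_FTC2 R f (gaussian_term k)); last 4 first.
  - by rewrite gtrN.
  - exact: continuous_subspaceT.
  - split; [by move=> x _; exact: ex_derive| |].
      exact/cvg_at_right_filter/continuous_gaussian_term.
    exact/cvg_at_left_filter/continuous_gaussian_term.
  - by move=> x _; rewrite derive1E; exact: derive_val.
  by rewrite EFinB.
move: cv; rewrite (_ : [sequence _]_n = EFin \o (fun n =>
   gaussian_term k n.+1%:R - gaussian_term k (- n.+1%:R))); last first.
  by apply/funext => n /=; rewrite int_f.
have c0 : (fun n => gaussian_term k n.+1%:R - gaussian_term k (- n.+1%:R)) @ \oo --> (0 : R).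
  have [C [C0 Ck]] := exprn_half_gauss_le k.+1.
  apply: (@squeeze_cvgr _ _ _ _ (fun n => - (C * 2) * harmonic n) (fun n => C * 2 * harmonic n)).
  - apply: nearW => n; rewrite mulNr -ler_norml (le_trans (ler_normB _ _))//.
    have bd (x : R) : `|x| = n.+1%:R -> `|gaussian_term k x| <= C * harmonic n.
      move=> xn; rewrite /harmonic /= ler_pdivlMr// mulrC -xn normrM normrX mulrA -exprS.
      rewrite (ger0_norm (expR_ge0 _)) (le_trans (Ck x))// ler_piMr//.
      by rewrite -expR0 ler_expR mulNr oppr_le0 divr_ge0// sqr_ge0.
    rewrite mulrAC mulr_natr mulr2n lerD// bd ?normrN ?ger0_norm//.
  - by rewrite -[X in _ --> X](mulr0 (- (C * 2))); apply: cvgMr; exact: cvg_harmonic.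
  - by rewrite -[X in _ --> X](mulr0 (C * 2)); apply: cvgMr; exact: cvg_harmonic.
move=> cv; rewrite /Rintegral.
suff -> : (\int[mu]_(x in setT) (f x)%:E = 0%:E)%E by [].
apply: (cvg_unique _ cv); first exact: ereal_hausdorff.
by apply: cvg_EFin; [exact: nearW|exact: c0].
Unshelve. all: by end_near. Qed.

End GaussianMoments.

(** * Polynomials in a nilpotent matrix *)

(** Evaluates a linear combination of matrices entrywise, down to its atoms. *)
Lemma mxlinE (F : pzRingType) m n (i : 'I_m) (j : 'I_n) :
  ((forall A B : 'M[F]_(m, n), ((A + B) i j = A i j + B i j)%R) *
   (forall A : 'M[F]_(m, n), ((- A) i j = - A i j)%R) *
   (forall (a : F) (A : 'M[F]_(m, n)), ((a *: A) i j = a * A i j)%R))%type.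
Proof. by split; [split|] => *; rewrite mxE. Qed.

(** Expands a product of square matrices into a linear combination of
   left-associated monomials, leaving the scalars alone. *)
Lemma mxdistE (F : comNzRingType) n :
  let M := 'M[F]_n.+1 in
  ((forall A B C : M, (A * (B * C) = A * B * C)%R) *
   (forall A : M, (A * 1 = A)%R) * (forall A : M, (1 * A = A)%R) *
   (forall A B C : M, ((A + B) * C = A * C + B * C)%R) *
   (forall A B C : M, (A * (B + C) = A * B + A * C)%R) *
   (forall A B : M, ((- A) * B = - (A * B))%R) *
   (forall A B : M, (A * (- B) = - (A * B))%R) *
   (forall a (A B : M), ((a *: A) * B = a *: (A * B))%R) *
   (forall a (A B : M), (A * (a *: B) = a *: (A * B))%R) *
   (forall a b (A : M), (a *: (b *: A) = (a * b) *: A)%R) *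
   (forall a (A : M), (a *: (- A) = - (a *: A))%R) *
   (forall a (A B : M), (a *: (A + B) = a *: A + a *: B)%R))%type.
Proof.
by do !split => *; rewrite ?mulrA ?mulr1 ?mul1r ?mulrDl ?mulrDr ?mulNr ?mulrN
  -?scalerAl -?scalerAr ?scalerA ?scalerN ?scalerDr.
Qed.

Ltac mxlin := apply/matrixP => ? ?; rewrite !mxlinE; ring.

Section Nilpotent.
Variables (F : fieldType) (p : nat).
Local Notation M := 'M[F]_p.+1.

Definition eq_mod_Xn n (q1 q2 : {poly F}) := forall i, (i < n)%N -> q1`_i = q2`_i.

Lemma eq_mod_Xn_mull n q q1 q2 : eq_mod_Xn n q1 q2 -> eq_mod_Xn n (q * q1) (q * q2).
Proof.
move=> q12 i ni; rewrite !coefM; apply: eq_bigr => j _; rewrite q12//.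
exact: leq_ltn_trans (leq_subr _ _) ni.
Qed.

Lemma eq_mod_Xn_deriv n q1 q2 : eq_mod_Xn n.+1 q1 q2 -> eq_mod_Xn n q1^`() q2^`().
Proof. by move=> q12 i ni; rewrite !coef_deriv q12. Qed.

Variables (A J : M).
Hypothesis nilA : A ^+ p.+1 = 0.
Hypothesis JA : J * A = A * J + A.
Local Notation phi := (horner_mx A).

Lemma horner_mx_eq_mod_Xn q1 q2 : eq_mod_Xn p.+1 q1 q2 -> phi q1 = phi q2.
Proof.
move=> q12; apply/eqP; rewrite -subr_eq0 -rmorphB /=.
have : 'X^(p.+1) %| q1 - q2.
  apply/Pdiv.Field.dvdpP; exists (drop_poly p.+1 (q1 - q2)).
  rewrite -[LHS](poly_take_drop p.+1); rewrite (_ : take_poly _ _ = 0) ?add0r//.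
  apply/polyP => i; rewrite coef_take_poly coef0 coefB.
  by case: ifP => // ni; rewrite q12// subrr.
move=> /Pdiv.Field.dvdpP[r ->].
by rewrite rmorphM rmorphXn /= horner_mx_X nilA mulr0.
Qed.

(** [J, .] is a derivation that fixes A, hence acts on polynomials in A as
    X d/dX. *)
Lemma J_horner_mx q : J * phi q = phi q * J + phi ('X * q^`()).
Proof.
elim/poly_ind: q => [|q c IH]; first by rewrite deriv0 mulr0 rmorph0 mulr0 mul0r addr0.
have EJ : phi ('X * (q * 'X + c%:P)^`()) = A * phi q^`() * A + A * phi q.
  rewrite derivD derivC addr0 derivM derivX mulr1 mulrDr !(rmorphD, rmorphM) /=.
  by rewrite horner_mx_X !mulrA.
have Aq : A * phi q = phi q * A by apply: comm_mx_horner.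
rewrite {}EJ !(rmorphD, rmorphM) /= horner_mx_X horner_mx_C.
rewrite mulrDr mulrA IH !(rmorphM, mulrDl) /= horner_mx_X -(mulrA _ J) JA mulrDr.
rewrite [J * _]comm_mx_scalar Aq !mulrA.
mxlin.
Qed.

End Nilpotent.

(** * Conjugation by the generating series in an sl2-triple *)

Section Sl2.
Variables (F : numFieldType) (p : nat).
Local Notation M := 'M[F]_p.+1.
Variables (A B J : M) (c d e : F).
Hypothesis nilA : A ^+ p.+1 = 0.
Hypothesis JA : J * A = A * J + A.
(* The bracket of the raising and lowering operators is an affine function of
   the Cartan element. *)
Hypothesis BA : B * A = A * B - ((4 * d) *: J - (2 * d * e) *: 1).
Local Notation phi := (horner_mx A).
Local Notation C := ((4 * d) *: J - (2 * d * e) *: (1 : M)).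

(** The bracket with B is a differential operator of second order on polynomials
    in A: the bracket of B with A is affine in J, and moving J to the right
    through the remaining factors A differentiates once more. *)
Lemma B_horner_mx q :
  B * phi q = phi q * B - phi q^`() * C - (2 * d) *: phi ('X * q^`()^`()).
Proof.
elim/poly_ind: q => [|q a IH].
  by rewrite !deriv0 mulr0 rmorph0 mulr0 !mul0r scaler0 !subr0.
have E1 : phi (q * 'X + a%:P)^`() = phi q + phi q^`() * A.
  by rewrite derivD derivC addr0 derivM derivX mulr1 addrC !(rmorphD, rmorphM) /= horner_mx_X.
have E2 : phi ('X * (q * 'X + a%:P)^`()^`()) =
    A * phi q^`() + A * phi q^`() + A * phi q^`()^`() * A.
  rewrite derivD derivC addr0 derivM derivX mulr1 derivD derivM derivX mulr1.
  by rewrite !mulrDr !mulrA !rmorphD !rmorphM /= horner_mx_X; mxlin.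
rewrite {}E1 {}E2 rmorphD rmorphM /= horner_mx_X horner_mx_C.
have Aq : A * phi q^`() = phi q^`() * A by apply: comm_mx_horner.
rewrite mulrDr [B * a%:M]comm_mx_scalar mulrA IH !rmorphM /= horner_mx_X.
rewrite -/(a%:M * B) !mxdistE -!(mulrA _ B A) BA !mxdistE Aq.
rewrite -!(mulrA _ J A) JA !mxdistE ?Aq.
mxlin.
Qed.

Variables (x : F) (U : {poly F}).
Local Notation y := (x%:P - 2^-1 *: 'X).
(* U is exp(x X - X^2/4) up to a constant factor and modulo a power of X.  The
   exponent p.+2 leaves the second derivative of U determined modulo X^(p.+1). *)
Hypothesis hU : eq_mod_Xn p.+2 U^`() (y * U).
Local Notation L := (phi U).
Variable Y : M.
Hypothesis YE : Y = x *: 1 - 2^-1 *: A.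

Let phiY : phi y = Y.
Proof.
by rewrite rmorphB /= linearZ /= horner_mx_X horner_mx_C -scalemx1 YE.
Qed.

Lemma Y_comm : Y * A = A * Y.
Proof. by rewrite -phiY; apply/esym; apply: comm_mx_horner. Qed.

Let phiU1 : phi U^`() = Y * L.
Proof.
rewrite -phiY -rmorphM /=; apply: horner_mx_eq_mod_Xn => // i ip.
by apply: hU; exact: ltnW.
Qed.

Let phiU2 : phi U^`()^`() = Y * Y * L - 2^-1 *: L.
Proof.
rewrite (@horner_mx_eq_mod_Xn _ _ _ nilA _ (y * (y * U) - 2^-1 *: U)).
  by rewrite rmorphB !rmorphM /= phiY linearZ mulrA.
move=> i ip; rewrite (eq_mod_Xn_deriv hU)//.
have dy : y^`() = - (2^-1)%:P by rewrite derivB derivC derivZ derivX sub0r -[2^-1 in RHS]mulr1 polyCM mul_polyC.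
rewrite derivM dy coefD mulNr coefN coefCM addrC coefB coefZ; congr (_ - _).
by apply: eq_mod_Xn_mull ip => j jp; apply: hU; exact: ltnW.
Qed.

(** Conjugation by L sends J to J - A Y. *)
Lemma J_exp_shift : J * L = L * J + A * Y * L.
Proof. by rewrite J_horner_mx// rmorphM /= horner_mx_X phiU1 mulrA. Qed.

Lemma B_exp_shift :
  B * L = L * B - Y * L * C - (2 * d) *: (A * Y * Y * L - 2^-1 *: (A * L)).
Proof.
rewrite B_horner_mx phiU1 rmorphM /= phiU2 horner_mx_X.
by rewrite !mxdistE.
Qed.

(** The conjugate of d J + c by L is affine in x; this is the adjoint of the
    polynomial Phi. *)
Lemma Phi_exp_shift :
  (d *: J - d *: (A * Y) + c *: 1) * L = L * (d *: J + c *: 1).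
Proof.
rewrite !mxdistE J_exp_shift !mxdistE; mxlin.
Qed.

Local Notation K := (2 *: (d *: (J - e *: 1) - c *: 1) : M).

(** On the right, conjugation of d J + c and of B by L each contributes a term of
    degree two in x, through Y A Y.  They cancel, and the terms of degree one
    combine to K. *)
Lemma Psi_exp_shift :
  (Y * K + (B - d *: A)) * L = (A - (2 * x) *: 1) * (L * (d *: J + c *: 1)) + L * B.
Proof.
have -> : A - (2 * x) *: 1 = - 2 *: Y by rewrite YE; apply/matrixP => i j; rewrite !mxlinE; field.
rewrite !mxdistE B_exp_shift !mxdistE -!(mulrA Y J L) J_exp_shift !mxdistE Y_comm.
by apply/matrixP => i j; rewrite !mxlinE; field.
Qed.

End Sl2.

(** * The matrices A, J and the raising operator *)

Section ConcreteMatrices.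
Variables (R : realType) (p : nat).
Local Notation M := 'M[R[i]]_p.+1.
Local Notation dg := (@dgmx R p).
Local Notation J := (Jmx R p).

Lemma dgmxE (a : nat -> R) i j : dg a i j = if i == j then (a i.+1)%:C else 0.
Proof. by rewrite !mxE; case: eqVneq => [->|]; rewrite ?mulr1n ?mulr0n. Qed.

Lemma dgmx_mul (a : nat -> R) (X : M) i j : (dg a * X) i j = (a i.+1)%:C * X i j.
Proof. by rewrite -[dg a * X]/(dg a *m X) mul_diag_mx !mxE. Qed.

Lemma mul_dgmx (a : nat -> R) (X : M) i j : (X * dg a) i j = X i j * (a j.+1)%:C.
Proof. by rewrite -[X * dg a]/(X *m dg a) mul_mx_diag !mxE. Qed.

Lemma eq_dgmx (a b : nat -> R) :
  (forall k, (1 <= k <= p.+1)%N -> a k = b k) -> dg a = dg b.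
Proof.
move=> ab; apply/matrixP => i j; rewrite !dgmxE; case: eqP => // _.
by rewrite ab//= ltn_ord.
Qed.

Lemma dgmxM (a b : nat -> R) : dg a * dg b = dg (fun k => a k * b k).
Proof.
apply/matrixP => i j; rewrite dgmx_mul !dgmxE; case: eqP => // _; last by rewrite mulr0.
by rewrite -rmorphM.
Qed.

Lemma dgmx1 : dg (fun=> 1) = 1.
Proof. by apply/matrixP => i j; rewrite dgmxE [RHS]mxE; case: eqP. Qed.

Lemma dgmx_affine (a b : R) : dg (fun k => a * k%:R + b) = a%:C *: J + (b%:C)%:M.
Proof.
apply/matrixP => i j; rewrite dgmxE [RHS]mxE [X in _ = X + _]mxE [X in _ = _ + X]mxE.
rewrite [Jmx R p i j]dgmxE; case: eqP => [->|/eqP/negPf ij]; last by rewrite mulr0 add0r.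
by rewrite mulr1n rmorphD rmorphM.
Qed.

Lemma dgmx_inv (a : nat -> R) : (forall k, (1 <= k <= p.+1)%N -> a k != 0) ->
  dg a \is a GRing.unit /\ (dg a)^-1 = dg (fun k => (a k)^-1).
Proof.
move=> a0; have E : dg (fun k => (a k)^-1) * dg a = 1.
  rewrite dgmxM -dgmx1; apply: eq_dgmx => k kp; rewrite mulVf//; exact: a0.
have E' : dg a * dg (fun k => (a k)^-1) = 1.
  rewrite dgmxM -dgmx1; apply: eq_dgmx => k kp; rewrite mulfV//; exact: a0.
have u : dg a \is a GRing.unit by apply/unitrP; exists (dg (fun k => (a k)^-1)).
by split=> //; rewrite -[LHS]mul1r -E mulrK.
Qed.

Lemma conj_realC (x : R) : Num.conj (x%:C) = x%:C.
Proof. by apply: conj_Creal; rewrite complex_real. Qed.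

Lemma dgmx_ct (a : nat -> R) : (dg a)^t* = dg a.
Proof.
apply/matrixP => i j; rewrite !mxE; case: eqVneq => [->|ij].
  by rewrite mulr1n conj_realC.
by rewrite mulr0n conjC0.
Qed.

Variables (alpha : nat -> R).
Hypothesis alpha0 : forall k, (1 <= k <= p.+1)%N -> alpha k != 0.
Local Notation A := (Aal p alpha).

Let alpha_ord (i : 'I_p.+1) : alpha i.+1 != 0.
Proof. by apply: alpha0; rewrite ltn_ord. Qed.

Lemma conj_dgmxE (X : M) i j :
  (dg alpha * X * (dg alpha)^-1) i j = X i j * (alpha i.+1 / alpha j.+1)%:C.
Proof.
have [_ ->] := dgmx_inv alpha0.
by rewrite mul_dgmx dgmx_mul rmorphM -mulrA mulrCA.
Qed.

Lemma AalE i j : A i j = if i == j.+1 :> nat then (2 * (alpha i.+1 / alpha j.+1))%:C else 0.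
Proof.
rewrite conj_dgmxE mxE; case: ifP => _; last by rewrite mul0r.
by rewrite [RHS]rmorphM /= (rmorph_nat (real_complex R) 2).
Qed.

Lemma Aal_expE k i j : (A ^+ k) i j =
  if i == (j + k)%N :> nat then (2 ^+ k * (alpha i.+1 / alpha j.+1))%:C else 0.
Proof.
elim: k i j => [|k IH] i j.
  rewrite expr0 addn0 mxE; case: (eqVneq i j) => [->|ij].
    by rewrite eqxx mulr1n mul1r divff.
  by rewrite [X in if X then _ else _](negPf ij).
rewrite exprS [LHS]mxE; case: ifP => [/eqP ijk|ijk].
  have hk : (j + k < p.+1)%N by rewrite (leq_trans _ (ltn_ord i))// ijk addnS.
  rewrite (bigD1 (Ordinal hk))//= big1 ?addr0; last first.
    move=> l lk; rewrite IH; case: eqP => [ljk|]; last by rewrite mulr0.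
    by move/eqP: lk; case; apply: val_inj.
  rewrite IH /= eqxx AalE /= ijk addnS eqxx -rmorphM /= exprS; congr (_%:C).
  have := alpha_ord (Ordinal hk); rewrite /= => ajk.
  have := alpha_ord j => aj; field; exact/andP.
rewrite big1// => l _; rewrite IH AalE.
case: eqP => [il|]; last by rewrite mul0r.
case: eqP => [ljk|]; last by rewrite mulr0.
by move: ijk; rewrite il ljk addnS eqxx.
Qed.

Lemma Aal_nilpotent : A ^+ p.+1 = 0.
Proof.
apply/matrixP => i j; rewrite Aal_expE mxE; case: eqP => // ij.
by have := ltn_ord i; rewrite ij -[X in (_ < X)%N]add0n ltn_add2r ltn0.
Qed.

Lemma Jmx_Aal : J * A = A * J + A.
Proof.
apply/matrixP => i j; rewrite /Jmx [RHS]mxE dgmx_mul mul_dgmx AalE.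
case: eqP => [->|_]; last by rewrite mulr0 mul0r addr0.
rewrite -!rmorphM /= -rmorphD /= -[j.+2%:R]natr1; congr (_%:C); ring.
Qed.

(** For d = 1 and alpha = 1 this is the raising operator of the irreducible
   sl2-module of dimension p.+1, in which Amx is twice the lowering operator
   and J is, up to an affine change, the Cartan element. *)
Definition Bmx (d : R) : M := \matrix_(i, j)
  if j == i.+1 :> nat
  then (d * i.+1%:R * (p%:R - i%:R) * (alpha i.+1 / alpha j.+1))%:C else 0.

Lemma Bmx_Aal d : Bmx d * A =
  A * Bmx d - ((4 * d%:C) *: J - (2 * d%:C * p.+2%:R) *: 1).
Proof.
have rc4 : 4 * d%:C = (4 * d)%:C by rewrite rmorphM /= (rmorph_nat (real_complex R) 4).
have rc2 : 2 * d%:C * p.+2%:R = (2 * d * p.+2%:R)%:C.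
  by rewrite !rmorphM /= (rmorph_nat (real_complex R) 2) (rmorph_nat (real_complex R) p.+2).
pose f k : R := 2 * d * k%:R * (p.+1%:R - k%:R).
have BAE : Bmx d * A = dg f.
  apply/matrixP => i j; rewrite dgmxE [LHS]mxE.
  have [ip|ip] := ltnP i.+1 p.+1.
    rewrite (bigD1 (Ordinal ip))//= big1 ?addr0; last first.
      move=> l li; rewrite mxE; case: eqP => [E|]; last by rewrite mul0r.
      by move/eqP: li; case; apply: val_inj.
    rewrite mxE /= eqxx AalE /= eqSS -val_eqE /=.
    case: eqP => [ij|]; last by rewrite mulr0.
    rewrite -rmorphM /f; congr (_%:C); rewrite -ij.
    rewrite -(natr1 i) -(natr1 p).
    have := alpha_ord (Ordinal ip); have := alpha_ord i; rewrite /= => a1 a2.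
    by field; apply/andP.
  have ipE : i = p :> nat by apply/eqP; rewrite eqn_leq -ltnS ltn_ord -ltnS.
  rewrite big1; last first.
    move=> l _; rewrite mxE; case: eqP => [E|]; last by rewrite mul0r.
    by have := ltn_ord l; rewrite E ltnNge ip.
  by rewrite /f ipE subrr mulr0; case: ifP.
have ABE : A * Bmx d = dg (fun k => f k.-1).
  apply/matrixP => i j; rewrite dgmxE [LHS]mxE /=.
  case: i => -[|i] ip /=.
    rewrite big1; last by move=> l _; rewrite AalE /= mul0r.
    by rewrite /f mulr0 mul0r; case: ifP.
  have hi : (i < p.+1)%N := ltnW ip.
  rewrite (bigD1 (Ordinal hi))//= big1 ?addr0; last first.
    move=> l li; rewrite AalE /= eqSS; case: eqP => [E|]; last by rewrite mul0r.
    by move/eqP: li; case; apply: val_inj.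
  rewrite AalE mxE /= eqxx [j == _ :> nat]eq_sym -val_eqE /=.
  case: eqP => [ij|]; last by rewrite mulr0.
  rewrite -rmorphM /f; congr (_%:C); rewrite -ij.
  have := alpha_ord (Ordinal hi); have := alpha_ord (Ordinal ip); rewrite /= => a1 a2.
  by rewrite -(natr1 i) -(natr1 p); field; apply/andP.
rewrite BAE ABE rc4 rc2 (_ : (2 * d * p.+2%:R)%:C *: 1 = (((2 * d * p.+2%:R)%:C)%:M : M)); last first.
  by rewrite -scalemx1.
have -> : (4 * d)%:C *: J - ((2 * d * p.+2%:R)%:C)%:M = dg (fun k => 4 * d * k%:R + - (2 * d * p.+2%:R)).
  by rewrite dgmx_affine rmorphN /= (raddfN (@scalar_mx _ _)).
apply/matrixP => i j; rewrite [RHS]mxE [X in _ = _ + X]mxE !dgmxE; case: ifP => _; last by rewrite subrr.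
rewrite -rmorphB /f /=; congr (_%:C); rewrite -(natr1 i) -(natr1 p.+1) -(natr1 p); ring.
Qed.

End ConcreteMatrices.

(** * The factor L as a function of A, and the exponential of A *)

Section LowerTriangularFactor.
Variables (R : realType) (p : nat) (H : nat -> {poly R}) (alpha : nat -> R).
Hypothesis hH : is_hermite H.
Hypothesis alpha0 : forall k, (1 <= k <= p.+1)%N -> alpha k != 0.
Local Notation M := 'M[R[i]]_p.+1.
Local Notation A := (Aal p alpha).
Local Notation J := (Jmx R p).
Local Notation L := (Lal p H alpha).
Local Notation phi := (horner_mx A).
Local Notation u := (scaled_hermite H).

(** Two coefficients more than A can see, so that the first two derivatives are
    those of the generating series to the needed order. *)
Definition hermite_poly (x : R) : {poly R[i]} := \poly_(i < p.+3) ((u i).[x])%:C.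

Lemma horner_mx_poly n (f : nat -> R[i]) :
  phi (\poly_(i < n) f i) = \sum_(i < n) f i *: A ^+ i.
Proof.
rewrite poly_def rmorph_sum; apply: eq_bigr => i _.
by rewrite /= linearZ /= rmorphXn /= horner_mx_X.
Qed.

Lemma Lal_horner x : L x = phi (hermite_poly x).
Proof.
rewrite horner_mx_poly; apply/matrixP => i j.
rewrite (conj_dgmxE alpha0) mxE summxE.
case: leqP => [ji|ij]; last first.
  rewrite mul0r big1// => k _; rewrite mxE (Aal_expE alpha0).
  by case: eqP => [E|]; rewrite ?mulr0//; move: ij; rewrite E ltnNge leq_addr.
have hk : (i - j < p.+3)%N.
  by rewrite (leq_ltn_trans (leq_subr _ _))// (leq_trans (ltn_ord i))// leqW.
rewrite (bigD1 (Ordinal hk))//= big1 ?addr0; last first.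
  move=> k /eqP kij; rewrite mxE (Aal_expE alpha0); case: eqP => [E|]; rewrite ?mulr0//.
  by case: kij; apply: val_inj => /=; rewrite E addKn.
rewrite mxE (Aal_expE alpha0) subnKC// eqxx -!rmorphM /=; congr (_%:C).
rewrite (hornerZ _ (H _)).
have : (2 : R) ^+ (i - j) != 0 by rewrite expf_neq0.
have : alpha j.+1 != 0 by apply: alpha0; rewrite ltn_ord.
have : ((i - j)`!%:R : R) != 0 by rewrite pnatr_eq0 -lt0n fact_gt0.
by move=> f0 aj e0; field; rewrite aj f0 e0.
Qed.

(** The recurrence of the Hermite polynomials is the differential equation
    U' = (x - X/2) U of the generating series exp(x X - X^2/4). *)
Lemma hermite_poly_ode x :
  eq_mod_Xn p.+2 (hermite_poly x)^`() (((x%:C)%:P - 2^-1 *: 'X) * hermite_poly x).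
Proof.
move=> i ip; rewrite coef_deriv coef_poly ltnS ip mulrBl coefB coefCM -scalerAl coefZ coefXM.
rewrite !coef_poly.
have -> : (i < p.+3)%N by rewrite ltnW.
case: i ip => [|i] ip /=.
  rewrite mulr0 subr0 mulr1n scaled_hermite1// scaled_hermite0// hornerX hornerC.
  by rewrite mulr1.
have -> : (i < p.+3)%N by rewrite ltnW// ltnW.
have := congr1 (fun q : {poly R} => (q.[x])%:C) (scaled_hermite_rec hH i).
rewrite hornerD hornerN hornerM hornerX (hornerZ _ (u _)) (hornerZ _ (u i)).
rewrite rmorphM rmorphB !rmorphM /= rmorphV ?unitfE// => E.
rewrite -[LHS]mulr_natl -(rmorph_nat (real_complex R) i.+2) E.
by rewrite -(rmorph_nat (real_complex R) 2).
Qed.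

Definition exp_poly (s : R) : {poly R[i]} := \poly_(i < p.+1) (s ^+ i / i`!%:R)%:C.
Definition exp_Aal (s : R) : M := phi (exp_poly s).
Local Notation E := exp_Aal.

(** Taylor's formula for the scaled Hermite polynomials, read as a product of
    generating series. *)
Lemma Lal_shift x s : L (x + s) = E s * L x.
Proof.
rewrite !Lal_horner /exp_Aal -rmorphM /=; apply: horner_mx_eq_mod_Xn; first exact: Aal_nilpotent.
move=> i ip; have ip3 : (i < p.+3)%N by apply: leq_trans ip _; rewrite ltnW.
rewrite coefM coef_poly ip3 scaled_hermite_shift// rmorph_sum; apply: eq_bigr => k _.
have -> : (exp_poly s)`_k = (s ^+ k / k`!%:R)%:C.
  by rewrite coef_poly ifT// (leq_trans (ltn_ord k)).
have -> : (hermite_poly x)`_(i - k) = ((u (i - k)).[x])%:C.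
  by rewrite coef_poly ifT// (leq_ltn_trans (leq_subr _ _)).
by rewrite rmorphM.
Qed.

Lemma Lal_unit x : L x \is a GRing.unit.
Proof.
rewrite -[_ \is a _]/(L x \in unitmx) unitmxE.
have Lt : is_trig_mx (L x).
  by apply/is_trig_mxP => i j ij; rewrite (conj_dgmxE alpha0) mxE leqNgt ij mul0r.
rewrite det_trig// big1 ?unitr1// => i _.
rewrite (conj_dgmxE alpha0) mxE leqnn subnn hermite0// hornerC fact0 divr1.
by rewrite mul1r divff// alpha0//= ltn_ord.
Qed.

(** Two opposite translations of the invertible matrix L(0) cancel. *)
Lemma exp_AalN s : E (- s) * E s = 1.
Proof.
apply: (mulIr (Lal_unit 0)); rewrite mul1r -mulrA -!Lal_shift.
by rewrite add0r subrr.
Qed.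

Lemma exp_Aal_unit s : E s \is a GRing.unit.
Proof. by apply/unitrP; exists (E (- s)); rewrite exp_AalN -{1}[s]opprK exp_AalN. Qed.

Lemma exp_AalV s : (E s)^-1 = E (- s).
Proof. by rewrite -[LHS]mul1r -(exp_AalN s) mulrK ?exp_Aal_unit. Qed.

Lemma exp_Aal_comm s : A * E s = E s * A.
Proof. exact: comm_mx_horner. Qed.

(** X d/dX multiplies the series exp(s X) by s X. *)
Lemma Jmx_exp_Aal s : J * E s = E s * (J + s%:C *: A).
Proof.
rewrite /exp_Aal J_horner_mx; last exact: Jmx_Aal.
rewrite mulrDr; congr (_ + _); rewrite -scalerAr -exp_Aal_comm.
rewrite (@horner_mx_eq_mod_Xn _ _ _ (Aal_nilpotent alpha0) _ (s%:C *: ('X * exp_poly s))).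
  by rewrite linearZ /= rmorphM /= horner_mx_X.
move=> i ip; rewrite coefXM coefZ coefXM; case: i ip => [|i] ip /=; first by rewrite mulr0.
rewrite coef_deriv !coef_poly ip ltnW// -[LHS]mulr_natl -(rmorph_nat (real_complex R) i.+1) -!rmorphM /=.
congr (_%:C); rewrite factS natrM exprS.
have : (i`!%:R : R) != 0 by rewrite pnatr_eq0 -lt0n fact_gt0.
have : (i.+1%:R : R) != 0 by rewrite pnatr_eq0.
by move: (i`!%:R : R) (i.+1%:R : R) (s ^+ i) => a b e b0 a0; field; rewrite a0 b0.
Qed.

(** A is nilpotent, so the exponential series is eventually constant. *)
Lemma mexp_Aal (s : R) : mexp (s%:C *: A) = E s.
Proof.
apply: lim_near_cst; first exact: norm_hausdorff.
near=> n; have pn : (p.+1 <= n)%N by near: n; exact: nbhs_infty_ge.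
rewrite /series /= (big_cat_nat _ (n := p.+1))//= [X in _ + X]big_nat_cond.
rewrite [X in _ + X]big1 ?addr0; last first.
  move=> i /andP[/andP[pi _] _]; have Ai : A ^+ i = 0 by rewrite -(subnKC pi) exprD (Aal_nilpotent alpha0) mul0r.
  by rewrite exprZn Ai !scaler0.
rewrite /exp_Aal horner_mx_poly big_mkord; apply: eq_bigr => i _.
rewrite exprZn scalerA; congr (_ *: _).
rewrite rmorphM /= rmorphXn /= mulrC; congr (_ * _).
by rewrite rmorphV ?unitfE ?pnatr_eq0 -?lt0n ?fact_gt0//= (rmorph_nat (real_complex R)).
Unshelve. all: by end_near. Qed.

End LowerTriangularFactor.

(** * Matrix polynomials against the Gaussian *)

Section MatrixPolynomials.
Variables (R : realType) (p : nat).
Local Notation M := 'M[R[i]]_p.+1.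
Implicit Types (Q : {poly M}) (a : M) (x : R).

Lemma mpevalM Q1 Q2 x : mpeval (Q1 * Q2) x = mpeval Q1 x * mpeval Q2 x.
Proof.
apply: hornerM_comm; rewrite /comm_poly.
exact: comm_scalar_mx.
Qed.

Lemma mpevalD Q1 Q2 x : mpeval (Q1 + Q2) x = mpeval Q1 x + mpeval Q2 x.
Proof. exact: hornerD. Qed.

Lemma mpevalN Q x : mpeval (- Q) x = - mpeval Q x.
Proof. exact: hornerN. Qed.

Lemma mpevalC a x : mpeval a%:P x = a.
Proof. exact: hornerC. Qed.

Lemma mpevalX x : mpeval 'X x = x%:C *: 1 :> M.
Proof. by rewrite /mpeval hornerX -scalemx1. Qed.

Lemma mpeval_coef_wide n Q x : (size Q <= n)%N ->
  mpeval Q x = \sum_(k < n) (x ^+ k)%:C *: Q`_k.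
Proof.
move=> sQ; rewrite /mpeval (horner_coef_wide _ sQ); apply: eq_bigr => k _.
by rewrite -rmorphXn -(rmorphXn (real_complex R)) /= [LHS]comm_mx_scalar [LHS]mul_scalar_mx.
Qed.

(** Entrywise, a polynomial that vanishes at all natural numbers is zero. *)
Lemma mpeval_eq0 Q : (forall x, mpeval Q x = 0) -> Q = 0.
Proof.
move=> Q0; apply/polyP => k; rewrite coef0; apply/matrixP => i j; rewrite mxE.
pose q : {poly R[i]} := \poly_(k < size Q) Q`_k i j.
have -> : Q`_k i j = q`_k.
  by rewrite coef_poly; case: ltnP => // sQ; rewrite nth_default// mxE.
rewrite (_ : q = 0) ?coef0//; apply: poly_nat_eq0 => n.
have := congr1 (fun X : M => X i j) (Q0 n%:R).
rewrite (mpeval_coef_wide _ (leqnn _)) summxE mxE => <-.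
rewrite horner_poly; apply: eq_bigr => l _.
by rewrite mxE mulrC rmorphXn /= (rmorph_nat (real_complex R)).
Qed.

Lemma mpeval_inj Q1 Q2 : (forall x, mpeval Q1 x = mpeval Q2 x) -> Q1 = Q2.
Proof.
move=> Q12; apply/eqP; rewrite -subr_eq0; apply/eqP/mpeval_eq0 => x.
by rewrite mpevalD mpevalN Q12 subrr.
Qed.

(** The integral of exp(-x^2) Q(x), see [mintegral_gauss].  The moments are
    scalars, so it is linear over constant matrices on both sides. *)
Definition gaussint Q : M := \sum_(k < size Q) (gauss_moment R k)%:C *: Q`_k.

Lemma gaussint_wide n Q : (size Q <= n)%N ->
  gaussint Q = \sum_(k < n) (gauss_moment R k)%:C *: Q`_k.
Proof.
move=> sQ; rewrite /gaussint (big_ord_widen _ (fun k => (gauss_moment R k)%:C *: Q`_k) sQ).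
rewrite big_mkcond; apply: eq_bigr => k _; case: ltnP => // sk.
by rewrite nth_default// scaler0.
Qed.

Lemma gaussintD Q1 Q2 : gaussint (Q1 + Q2) = gaussint Q1 + gaussint Q2.
Proof.
pose n := maxn (size Q1) (size Q2).
rewrite (@gaussint_wide n) ?(leq_trans (size_polyD _ _))// (@gaussint_wide n Q1) ?leq_maxl//.
rewrite (@gaussint_wide n Q2) ?leq_maxr// -big_split; apply: eq_bigr => k _.
by rewrite coefD scalerDr.
Qed.

Lemma gaussintN Q : gaussint (- Q) = - gaussint Q.
Proof.
rewrite /gaussint size_polyN -sumrN; apply: eq_bigr => k _.
by rewrite coefN scalerN.
Qed.

Lemma gaussintMl a Q : gaussint (a%:P * Q) = a * gaussint Q.
Proof.
rewrite (@gaussint_wide (size Q)); last first.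
  by apply/leq_sizeP => k sk; rewrite coefCM nth_default// mulr0.
rewrite mulr_sumr; apply: eq_bigr => k _.
by rewrite coefCM scalerAr.
Qed.

Lemma gaussintMr a Q : gaussint (Q * a%:P) = gaussint Q * a.
Proof.
rewrite (@gaussint_wide (size Q)); last first.
  by apply/leq_sizeP => k sk; rewrite coefMC nth_default// mul0r.
rewrite /gaussint mulr_suml; apply: eq_bigr => k _.
by rewrite coefMC scalerAl.
Qed.

(** The polynomial factor of the derivative of exp(-x^2) Q(x). *)
Definition gaussderiv Q : {poly M} := Q^`() - 'X * Q *+ 2.

Lemma gaussint_gaussderiv Q : gaussint (gaussderiv Q) = 0.
Proof.
have sX : (size ('X * Q)%R <= (size Q).+1)%N.
  by rewrite (leq_trans (size_polyMleq _ _))// size_polyX.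
have sX2 : (size ('X * Q *+ 2)%R <= (size Q).+1)%N.
  by apply/leq_sizeP => k sk; rewrite coefMn (leq_sizeP _ _ sX)// mul0rn.
have sd : (size Q^`() <= size Q)%N by apply/leq_sizeP => k sk; rewrite coef_deriv nth_default ?mul0rn// ltnW.
rewrite /gaussderiv gaussintD gaussintN (gaussint_wide sd) (gaussint_wide sX2) big_ord_recl.
rewrite coefMn coefXM eqxx mul0rn scaler0 add0r.
case sQ : (size Q) => [|n]; first by rewrite !big_ord0 subrr.
rewrite big_ord_recr /= coef_deriv nth_default ?sQ// mul0rn scaler0 addr0.
rewrite big_ord_recl /= !coefMn !coefXM /=.
have m1 : gauss_moment R 1 = 0.
  by have /eqP := gauss_moment_rec R 0; rewrite mul0r eq_sym mulf_eq0 pnatr_eq0 => /eqP.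
rewrite [gauss_moment R (bump 0 0)]m1 scale0r add0r -sumrB big1// => k _.
rewrite coef_deriv coefMn coefXM /= /bump /= !add1n -(scaler_nat k.+1) -(scaler_nat 2) !scalerA -scalerBl.
have -> : (gauss_moment R k)%:C * k.+1%:R - (gauss_moment R k.+2)%:C * 2%:R = 0.
  apply/eqP; rewrite subr_eq0; apply/eqP.
  rewrite -(rmorph_nat (real_complex R) k.+1) -(rmorph_nat (real_complex R) 2) -!rmorphM /=.
  by congr (_%:C); rewrite mulrC (gauss_moment_rec R k.+1) mulrC.
by rewrite scale0r.
Qed.

Lemma mintegral_gauss Q :
  mintegral (fun x => (expR (- x ^+ 2))%:C *: mpeval Q x) = gaussint Q.
Proof.
apply/matrixP => i j; rewrite mxE summxE.
pose qr : {poly R} := \poly_(k < size Q) complex.Re (Q`_k i j).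
pose qi : {poly R} := \poly_(k < size Q) complex.Im (Q`_k i j).
have evE x : mpeval Q x i j = (qr.[x] +i* qi.[x])%C.
  rewrite (mpeval_coef_wide _ (leqnn _)) summxE !horner_poly.
  elim/big_rec3: _ => // k a b z _ ->.
  rewrite mxE; case: (Q`_k i j) => r s /=; simpc.
  by congr (_ +i* _)%C; rewrite mulrC.
have intE (f : R -> R) q (g : nat -> R) n : (forall x, f x = q.[x] * expR (- x ^+ 2)) ->
    q = \poly_(k < n) g k ->
    \int[lebesgue_measure]_(x in setT) f x = \sum_(k < n) gauss_moment R k * g k.
  move=> fE qE; have -> : f = fun x => q.[x] * expR (- x ^+ 2) by exact/funext.
  rewrite integral_gaussian_poly.
  have sq : (size q <= n)%N by rewrite qE size_poly.
  rewrite (big_ord_widen _ (fun k => q`_k * gauss_moment R k) sq) big_mkcond.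
  apply: eq_bigr => k _; rewrite mulrC qE coef_poly ltn_ord.
  case: ltnP => // sk; have := nth_default 0 sk; rewrite coef_poly ltn_ord => ->.
  by rewrite mulr0.
rewrite (intE _ qr _ _ _ erefl) ?(intE _ qi _ _ _ erefl); last 2 first.
- by move=> x; rewrite mxE evE; simpc; rewrite /= mulrC.
- by move=> x; rewrite mxE evE; simpc; rewrite /= mulrC.
elim/big_rec3: _ => // k a b z _ E.
rewrite mxE -E; case: (Q`_k i j) => r s /=; simpc.
by [].
Qed.

End MatrixPolynomials.

(** * Adjoints *)

Section ConjugateTranspose.
Variables (R : realType) (p : nat).
Local Notation M := 'M[R[i]]_p.+1.
Implicit Types (X Y : M) (Q : {poly M}).

Lemma ctE X i j : X^t* i j = Num.conj (X j i).
Proof. by rewrite !mxE. Qed.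

Lemma ctD X Y : (X + Y)^t* = X^t* + Y^t*.
Proof. by apply/matrixP => i j; rewrite !mxE rmorphD. Qed.

Lemma ct0 : (0 : M)^t* = 0.
Proof. by apply/matrixP => i j; rewrite !mxE conjC0. Qed.

Lemma ctM X Y : (X * Y)^t* = Y^t* * X^t*.
Proof. by rewrite -[X * Y]/(X *m Y) trmx_mul map_mxM. Qed.

Lemma ctZ (a : R) X : (a%:C *: X)^t* = a%:C *: X^t*.
Proof. by apply/matrixP => i j; rewrite !mxE rmorphM; congr (_ * _); exact: conj_realC. Qed.

Lemma ct1 : (1 : M)^t* = 1.
Proof. by rewrite trmx1 map_mx1. Qed.

Lemma ctK X : X^t*^t* = X.
Proof. exact: trmxCK. Qed.

Lemma ct_unit X : (X^t* \is a GRing.unit) = (X \is a GRing.unit).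
Proof.
by rewrite -[LHS]/(X^t* \in unitmx) map_unitmx unitmx_tr.
Qed.

Lemma ctV X : X \is a GRing.unit -> (X^-1)^t* = (X^t*)^-1.
Proof.
move=> Xu; have XVX : (X^-1)^t* * X^t* = 1 by rewrite -ctM mulrV// ct1.
by rewrite -[LHS]mulr1 -(mulrV (_ : X^t* \is a GRing.unit)) ?ct_unit// mulrA XVX mul1r.
Qed.

(** Its value at a real x is the adjoint of Q(x). *)
Definition ctp Q : {poly M} := \poly_(k < size Q) (Q`_k)^t*.

Lemma coef_ctp Q k : (ctp Q)`_k = (Q`_k)^t*.
Proof. by rewrite coef_poly; case: ltnP => // sk; rewrite nth_default// ct0. Qed.

Lemma mpeval_ctp Q x : mpeval (ctp Q) x = (mpeval Q x)^t*.
Proof.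
rewrite (mpeval_coef_wide _ (size_poly _ _)) (mpeval_coef_wide _ (leqnn _)).
have ct_sum (I : finType) (F : I -> M) : (\sum_i F i)^t* = \sum_i (F i)^t*.
  by elim/big_rec2: _ => [|k X Y _ <-]; rewrite ?ct0 ?ctD.
by rewrite ct_sum; apply: eq_bigr => k _; rewrite ctZ -coef_ctp.
Qed.

Lemma deriv_ctp Q : (ctp Q)^`() = ctp Q^`().
Proof.
apply/polyP => k; rewrite coef_deriv !coef_ctp coef_deriv.
by move: (Q`_k.+1) => X; elim: k.+1 => [|n IH]; rewrite ?mulr0n ?ct0// !mulrS ctD IH.
Qed.

Lemma size_ctp Q : (size (ctp Q) <= size Q)%N.
Proof. exact: size_poly. Qed.

End ConjugateTranspose.

(** * The factor L as a polynomial in x *)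

Section PearsonPolynomials.
Variables (R : realType) (p : nat) (H : nat -> {poly R}) (alpha : nat -> R).
Hypothesis hH : is_hermite H.
Hypothesis alpha0 : forall k, (1 <= k <= p.+1)%N -> alpha k != 0.
Local Notation M := 'M[R[i]]_p.+1.
Local Notation A := (Aal p alpha).
Local Notation J := (Jmx R p).
Local Notation L := (Lal p H alpha).
Local Notation u := (scaled_hermite H).

Definition Lpoly : {poly M} :=
  \sum_(i < p.+1) (A ^+ i)%:P * map_poly (@scalar_mx _ p.+1 \o real_complex R) (u i).

Lemma mpeval_Lpoly x : mpeval Lpoly x = L x.
Proof.
rewrite (Lal_horner H alpha0) horner_mx_poly 2!big_ord_recr /=.
rewrite (exprS _ p.+1) (Aal_nilpotent alpha0) mulr0 !scaler0 !addr0.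
rewrite /mpeval /Lpoly horner_sum; apply: eq_bigr => i _.
rewrite hornerCM -[(x%:C)%:M]/((@scalar_mx _ p.+1 \o real_complex R) x) horner_map /=.
by rewrite [LHS]comm_mx_scalar [LHS]mul_scalar_mx.
Qed.

(** Differentiation lowers the index of the scaled Hermite polynomials;
    A^(p.+1) = 0 accounts for the term lost at the end of the sum. *)
Lemma deriv_Lpoly : Lpoly^`() = A%:P * Lpoly.
Proof.
rewrite /Lpoly raddf_sum mulr_sumr big_ord_recl big_ord_recr /=.
rewrite !mulrA -rmorphM /= -exprS (Aal_nilpotent alpha0) mul0r addr0.
rewrite derivM derivC mul0r add0r deriv_map (scaled_hermite0 hH) derivC.
rewrite raddf0 mulr0 add0r; apply: eq_bigr => i _.
rewrite derivM derivC mul0r add0r deriv_map (deriv_scaled_hermite hH).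
by rewrite mulrA -rmorphM /= -exprS.
Qed.

End PearsonPolynomials.

(** * Integration by parts and translation *)

Section GaussianDerivation.
Variables (R : realType) (p : nat).
Local Notation M := 'M[R[i]]_p.+1.
Implicit Types Q F : {poly M}.

Lemma gaussderivD Q1 Q2 : gaussderiv (Q1 + Q2) = gaussderiv Q1 + gaussderiv Q2.
Proof. by rewrite /gaussderiv derivD mulrDr mulrnDl opprD addrACA. Qed.

Lemma gaussderivMl Q F : gaussderiv (Q * F) = Q^`() * F + Q * gaussderiv F.
Proof.
rewrite /gaussderiv derivM mulrBr addrA; congr (_ - _).
by rewrite mulrnAr !mulrA commr_polyX.
Qed.

Lemma gaussderivMr F Q : gaussderiv (F * Q) = gaussderiv F * Q + F * Q^`().
Proof. by rewrite /gaussderiv derivM mulrBl addrAC mulrnAl !mulrA. Qed.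

Lemma gaussderivMC a F : gaussderiv (a%:P * F) = a%:P * gaussderiv F.
Proof. by rewrite gaussderivMl derivC mul0r add0r. Qed.

Lemma gaussderivCM F a : gaussderiv (F * a%:P) = gaussderiv F * a%:P.
Proof. by rewrite gaussderivMr derivC mulr0 addr0. Qed.

(** Integrating by parts n times differentiates Q to zero. *)
Lemma gaussint_iter_gaussderiv n F Q :
  (size Q <= n)%N -> gaussint (iter n (@gaussderiv R p) F * Q) = 0.
Proof.
elim: n Q => [|n IH] Q sQ.
  by move: sQ; rewrite leqn0 size_poly_eq0 => /eqP ->; rewrite mulr0 /gaussint size_poly0 big_ord0.
rewrite iterS (_ : gaussderiv _ * Q = gaussderiv (iter n (@gaussderiv R p) F * Q) - iter n (@gaussderiv R p) F * Q^`()).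
  rewrite gaussintD gaussintN gaussint_gaussderiv IH ?subrr//.
  by apply/leq_sizeP => k nk; rewrite coef_deriv nth_default ?mul0rn// (leq_trans sQ).
by rewrite gaussderivMr addrK.
Qed.

End GaussianDerivation.

(** The derivative of exp(-x^2) X D Xc for factors with X' = A X and
    Xc' = Ac Xc, with the Gaussian term joined to A. *)
Lemma leibniz_arrange (F : comNzRingType) n (A X D Ac Xc : 'M[F]_n.+1) (x : F) :
  A * X * D * Xc + X * D * (Ac * Xc) - (x *: 1 * (X * D * Xc) + x *: 1 * (X * D * Xc)) =
  (A - (2 * x) *: 1) * (X * D * Xc) + X * D * Ac * Xc.
Proof. by rewrite !mxdistE; mxlin. Qed.


Lemma pascal_sum (V : nmodType) (v : nat -> V) n :
  \sum_(k < n.+1) v k *+ 'C(n, k) + \sum_(k < n.+1) v k.+1 *+ 'C(n, k)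
  = \sum_(k < n.+2) v k *+ 'C(n.+1, k).
Proof.
rewrite big_ord_recl [X in _ + X]big_ord_recr [RHS]big_ord_recl big_ord_recr /=.
rewrite !bin0 !binn -addrA; congr (_ + _); rewrite addrA -big_split /=.
congr (_ + _); apply: eq_bigr => k _.
by rewrite /bump /= !add1n binS mulrnDr.
Qed.

Section Translation.
Variables (R : realType) (p : nat).
Local Notation M := 'M[R[i]]_p.+1.
Local Notation gd := (@gaussderiv R p).
Implicit Types (F G Q : {poly M}) (s x : R).

Definition transl s Q : {poly M} := Q \Po ('X + ((s%:C)%:M)%:P).

Lemma mpeval_transl s Q x : mpeval (transl s Q) x = mpeval Q (x + s).
Proof.
elim/poly_ind: Q => [|Q c IH]; first by rewrite /transl comp_poly0 /mpeval !horner0.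
rewrite /transl comp_poly_MXaddC mpevalD mpevalM IH mpevalD mpevalX !mpevalC.
by rewrite mpevalD mpevalM mpevalX mpevalC rmorphD scalerDl -scalemx1.
Qed.

Lemma deriv_transl s Q : (transl s Q)^`() = transl s Q^`().
Proof.
elim/poly_ind: Q => [|Q c IH]; first by rewrite /transl deriv0 comp_poly0 deriv0.
rewrite /transl comp_poly_MXaddC derivD derivC addr0 derivM IH.
rewrite derivD derivC addr0 derivX mulr1.
rewrite [in RHS]derivD derivC addr0 derivM derivX mulr1 comp_polyD.
by rewrite -[_ * 'X]addr0 -polyC0 comp_poly_MXaddC polyC0 addr0.
Qed.

(** The Gaussian itself is translated to exp(-2 s x - s^2) exp(-x^2), whose
    first factor contributes the multiplication by 2 s. *)
Lemma transl_gaussderiv s Q :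
  transl s (gd Q) = gd (transl s Q) - (((2 * s)%:C)%:M : M) *: transl s Q.
Proof.
apply: mpeval_inj => x; rewrite mpeval_transl /gaussderiv !mulr2n !(mpevalD, mpevalN, mpevalM).
rewrite deriv_transl !mpeval_transl !mpevalX -mul_polyC mpevalM mpevalC mpeval_transl.
rewrite -scalemx1 rmorphM rmorphD /= (rmorph_nat (real_complex R) 2).
move: (mpeval Q^`() _) (mpeval Q _) => X Z.
by rewrite !mxdistE; mxlin.
Qed.

(** The binomial expansion of the n-th power of the derivation minus 2 s. *)
Lemma transl_iter_gaussderiv n s F :
  transl s (iter n gd F) = \sum_(k < n.+1)
    (((((- (2 * s)) ^+ k)%:C)%:M : M) *: iter (n - k) gd (transl s F)) *+ 'C(n, k).
Proof.
have gdZ (a : M) Q : gd (a *: Q) = a *: gd Q by rewrite -!mul_polyC gaussderivMC.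
have gd0 : gd 0 = 0 by rewrite /gaussderiv deriv0 mulr0 mul0rn subrr.
have gd_sum m (f : 'I_m -> {poly M}) : gd (\sum_i f i) = \sum_i gd (f i).
  by elim/big_rec2: _ => [|i y z _ <-]; rewrite ?gd0 ?gaussderivD.
have gdMn Q m : gd (Q *+ m) = gd Q *+ m.
  by elim: m => [|m IH]; rewrite ?mulr0n ?gd0// !mulrS gaussderivD IH.
elim: n => [|n IH]; first by rewrite big_ord1 bin0 expr0 scale1r mulr1n.
pose v k := ((((- (2 * s)) ^+ k)%:C)%:M : M) *: iter (n.+1 - k) gd (transl s F).
rewrite iterS transl_gaussderiv IH gd_sum -[RHS](pascal_sum v); congr (_ + _).
  apply: eq_bigr => k _; rewrite gdMn gdZ /v subSn -1?ltnS//.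
rewrite scaler_sumr -sumrN; apply: eq_bigr => k _.
rewrite -scalerMnr -mulNrn -scaleNr scalerA /v subSS exprS; congr (_ *: _ *+ _).
by rewrite [in RHS]rmorphM rmorphN /= mulNr [in RHS]mulNr (raddfN (@scalar_mx _ _)) /= scalar_mxM.
Qed.

End Translation.

(** * Uniqueness of orthogonal matrix polynomials *)

Section OrthogonalPolynomials.
Variables (R : realType) (p : nat).
Local Notation M := 'M[R[i]]_p.+1.
Local Notation dg := (@dgmx R p).
Implicit Types D F Q : {poly M}.

Lemma Re_sum n (F : 'I_n -> R[i]) :
  complex.Re (\sum_i F i) = \sum_i complex.Re (F i).
Proof.
elim/big_rec2: _ => // i a b _ <-.
by case: (F i) b => [? ?] [? ?].
Qed.

(** The trace is a sum of squared moduli with positive weights. *)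
Lemma tr_form_ge0 (X : M) (a : nat -> R) :
  (forall k, (1 <= k <= p.+1)%N -> 0 < a k) ->
  0 <= \tr (X * dg a * X^t*) /\ (\tr (X * dg a * X^t*) = 0 -> X = 0).
Proof.
move=> a0.
have trE : \tr (X * dg a * X^t*) = \sum_i \sum_k (a (val k).+1)%:C * `|X i k| ^+ 2.
  apply: eq_bigr => i _; rewrite mxE; apply: eq_bigr => k _.
  by rewrite ctE mul_dgmx normCK mulrAC mulrC.
have ge0 (i k : 'I_p.+1) : 0 <= (a (val k).+1)%:C * `|X i k| ^+ 2.
  by rewrite mulr_ge0// ?exprn_ge0// ler0c ltW// a0//= ltn_ord.
rewrite trE; split; first by apply: sumr_ge0 => i _; apply: sumr_ge0.
move=> /eqP; rewrite psumr_eq0 => [/allP h|]; last by move=> i _; apply: sumr_ge0.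
apply/matrixP => i k; have := h i (mem_index_enum _); rewrite implyTb.
rewrite psumr_eq0// => /allP /(_ k (mem_index_enum _)); rewrite implyTb.
rewrite mulf_eq0 expf_eq0 /= normr_eq0 mxE => /orP[|/eqP//].
have -> : ((a k.+1)%:C == 0) = (a k.+1 == 0) by rewrite eq_complex /= eqxx andbT.
by rewrite gt_eqF// a0//= ltn_ord.
Qed.

Variables (L : R -> M) (V : {poly M}) (a : nat -> R).
Hypothesis a_gt0 : forall k, (1 <= k <= p.+1)%N -> 0 < a k.
Hypothesis L_unit : forall x, L x \is a GRing.unit.
Hypothesis VE : forall x, mpeval V x = L x * dg a * (L x)^t*.

(** The trace of D V D^t* is a non-negative real polynomial whose Gaussian
    integral vanishes; it is therefore zero, and so is D L pointwise. *)
Lemma gaussint_form_eq0 D : gaussint (D * V * ctp D) = 0 -> D = 0.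
Proof.
move=> D0; pose T := D * V * ctp D.
have TE x : mpeval T x = (mpeval D x * L x) * dg a * (mpeval D x * L x)^t*.
  by rewrite !mpevalM VE mpeval_ctp ctM !mulrA.
pose q : {poly R} := \poly_(k < size T) complex.Re (\tr (T`_k)).
have qE x : q.[x] = complex.Re (\tr (mpeval T x)).
  rewrite horner_poly (mpeval_coef_wide _ (leqnn _)) (raddf_sum (@mxtrace _ _)) Re_sum.
  apply: eq_bigr => k _ /=; rewrite mxtraceZ; case: (\tr _) => r s /=; simpc.
  by rewrite mulrC.
have q0 : q = 0.
  apply: gaussian_poly_eq0.
    move=> x; rewrite qE TE.
    by have [+ _] := tr_form_ge0 (mpeval D x * L x) a_gt0; rewrite lecE => /andP[].
  rewrite integral_gaussian_poly.
  transitivity (complex.Re (\tr (gaussint T))); last by rewrite D0 raddf0.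
  rewrite /gaussint (raddf_sum (@mxtrace _ _)) Re_sum.
  rewrite (big_ord_widen _ (fun k => q`_k * gauss_moment R k) (size_poly _ _)) big_mkcond.
  apply: eq_bigr => k _ /=; rewrite mxtraceZ.
  have -> : q`_k = complex.Re (\tr T`_k) by rewrite coef_poly ltn_ord.
  have -> : (if (k < size q)%N then complex.Re (\tr T`_k) * gauss_moment R k else 0) =
      complex.Re (\tr T`_k) * gauss_moment R k.
    case: ltnP => // sq; have := nth_default 0 sq; rewrite coef_poly ltn_ord => ->.
    by rewrite mul0r.
  by case: (\tr _) => r s /=; simpc; rewrite mulrC.
apply: mpeval_eq0 => x.
have [ge0 eq0] := tr_form_ge0 (mpeval D x * L x) a_gt0.
apply: (mulIr (L_unit x)); rewrite mul0r; apply: eq0.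
have := qE x; rewrite q0 horner0 TE; move: ge0.
by case: (\tr _) => r s; rewrite lecE /= => /andP[/eqP -> _] <-.
Qed.

Lemma ctpD Q1 Q2 : ctp (Q1 + Q2) = ctp Q1 + ctp Q2.
Proof. by apply/polyP => k; rewrite coefD !coef_ctp coefD ctD. Qed.

Lemma ctpMl b Q : ctp (b%:P * Q) = ctp Q * (b^t*)%:P.
Proof. by apply/polyP => k; rewrite coefMC !coef_ctp coefCM ctM. Qed.

Variable P : nat -> {poly M}.
Hypothesis P_monic : forall n, size (P n) = n.+1 /\ lead_coef (P n) = 1.
Hypothesis P_orth : forall n m, n <> m -> gaussint (P n * V * ctp (P m)) = 0.

(** Monic orthogonal polynomials of all degrees span all polynomials over
    constant matrices. *)
Lemma mop_orth n D : (size D <= n)%N -> gaussint (P n * V * ctp D) = 0.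
Proof.
suff h m : (m <= n)%N -> forall D, (size D <= m)%N -> gaussint (P n * V * ctp D) = 0.
  exact: h.
elim: m => [|m IH] mn {}D sD.
  move: sD; rewrite leqn0 size_poly_eq0 => /eqP ->.
  by rewrite /ctp size_poly0 poly_def big_ord0 mulr0 /gaussint size_poly0 big_ord0.
have [sP lP] := P_monic m.
pose D' := D - (D`_m)%:P * P m.
have DE : D = D' + (D`_m)%:P * P m by rewrite subrK.
rewrite DE ctpD ctpMl mulrDr gaussintD mulrA gaussintMr P_orth ?mul0r ?addr0; last first.
  by move=> nm; move: mn; rewrite nm ltnn.
apply: IH; first exact: ltnW.
apply/leq_sizeP => k; rewrite leq_eqVlt => /predU1P[<-|mk].
  by move: lP; rewrite coefB coefCM lead_coefE sP /= => ->; rewrite mulr1 subrr.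
rewrite coefB coefCM (nth_default _ (leq_trans sD mk)).
by rewrite [(P m)`_k]nth_default ?sP// mulr0 subrr.
Qed.

(** The difference of the two polynomials has smaller degree and is orthogonal to
    all polynomials of smaller degree, hence to itself. *)
Lemma mop_unique n Q : (size Q <= n.+1)%N -> Q`_n = 1 ->
  (forall D, (size D <= n)%N -> gaussint (Q * V * ctp D) = 0) -> P n = Q.
Proof.
move=> sQ Qn Qorth; have [sP lP] := P_monic n.
apply/eqP; rewrite -subr_eq0; apply/eqP.
have sD : (size (P n - Q)%R <= n)%N.
  apply/leq_sizeP => k; rewrite coefB leq_eqVlt => /predU1P[<-|nk].
    by move: lP; rewrite lead_coefE sP /= Qn => ->; rewrite subrr.
  by rewrite !nth_default ?sP// ?subrr// (leq_trans sQ).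
apply: gaussint_form_eq0; rewrite !mulrBl gaussintD gaussintN Qorth// mop_orth//.
by rewrite subr0.
Qed.

End OrthogonalPolynomials.

(** * Pearson equations and the Rodrigues formula *)

Section Rodrigues.
Variables (R : realType) (p : nat) (H : nat -> {poly R}) (alpha : nat -> R).
Variables (delta : nat -> nat -> R) (c d : nat -> R).
Hypothesis hH : is_hermite H.
Hypothesis alpha0 : forall k, (1 <= k <= p.+1)%N -> alpha k != 0.
Hypothesis delta_gt0 : forall j k, (1 <= k <= p.+1)%N -> 0 < delta j k.
Hypothesis c_gt0 : forall j, 0 < c j.
Hypothesis d_gt0 : forall j, 0 < d j.
Local Notation M := 'M[R[i]]_p.+1.
Local Notation dg := (@dgmx R p).
Local Notation A := (Aal p alpha).
Local Notation J := (Jmx R p).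
Local Notation L := (Lal p H alpha).
Hypothesis hDelta : forall j,
  dg (delta j.+1) = ((d j)%:C *: J + ((c j)%:C)%:M) * dg (delta j).
Hypothesis halpha : forall j k, (1 <= k <= p)%N ->
  alpha k.+1 ^+ 2 / alpha k ^+ 2 =
  d j * k%:R * (p.+1%:R - k%:R) / (2 * (d j * k%:R + c j)) * (delta j k.+1 / delta j k).
Local Notation B j := (Bmx p alpha (d j)).

Lemma deltaS j k : (1 <= k <= p.+1)%N ->
  delta j.+1 k = (d j * k%:R + c j) * delta j k.
Proof.
case: k => // k kp; have := congr1 (fun X : M => X (Ordinal kp) (Ordinal kp)) (hDelta j).
rewrite -dgmx_affine dgmxM !dgmxE eqxx => /complexI ->.
by [].
Qed.

Lemma affine_gt0 j k : 0 < d j * k%:R + c j.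
Proof. by rewrite ltr_wpDl ?c_gt0// mulr_ge0// ltW. Qed.

(** The standing assumption on the ratios of the alpha_k says exactly that
    the two diagonal matrices carry the adjoint of A to the raising operator. *)
Lemma Delta_ctA j : dg (delta j.+1) * A^t* = B j * dg (delta j).
Proof.
apply/matrixP => i k; rewrite dgmx_mul mul_dgmx [B j i k]mxE ctE (AalE alpha0).
case: eqP => ki; last by rewrite conjC0 mulr0 mul0r.
have ip : (1 <= i.+1 <= p)%N by rewrite /= -ltnS -ki.
rewrite conj_realC -!rmorphM /=; congr (_%:C).
rewrite deltaS ?ltn_ord// ki.
have a1 : alpha i.+1 != 0 by rewrite alpha0// ltn_ord.
have a2 : alpha i.+2 != 0 by rewrite alpha0// -ki ltn_ord.
have d1 : delta j i.+1 != 0 by rewrite gt_eqF// delta_gt0// ltn_ord.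
have e0 : d j * i.+1%:R + c j != 0 by rewrite gt_eqF// affine_gt0.
have /(congr1 (fun z => z * (alpha i.+1 / alpha i.+2 * (2 * (d j * i.+1%:R + c j) * delta j i.+1)))) := halpha j ip.
rewrite (_ : p%:R - i%:R = p.+1%:R - i.+1%:R); last by rewrite -!natr1; ring.
move: (i.+1%:R) (p.+1%:R : R) e0 => r s e0 E.
apply: (etrans _ (etrans E _)).
  by field; apply/andP.
by field; rewrite ?e0 ?a2 ?d1.
Qed.

Definition Kseq j : M := 2 *: ((d j)%:C *: (J - (p.+2%:R)%:M) - ((c j)%:C)%:M).

(** The weight without its Gaussian factor. *)
Definition Vpoly j : {poly M} := Lpoly p H alpha * (dg (delta j))%:P * ctp (Lpoly p H alpha).

(** Phip and Psip are the adjoints of the Phi and Psi of the Pearson equations: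
    they multiply the weight on the left.  Their values are the left factors in
    [Phi_exp_shift] and [Psi_exp_shift], here expanded in powers of x. *)
Definition Phip j : {poly M} :=
  (- (d j)%:C *: A)%:P * 'X + ((d j)%:C *: J + (c j)%:C *: 1 + ((d j)%:C / 2) *: (A * A))%:P.
Definition Psip j : {poly M} :=
  (Kseq j)%:P * 'X + (B j - (d j)%:C *: A - 2^-1 *: (A * Kseq j))%:P.

Lemma KseqE j : Kseq j = 2 *: ((d j)%:C *: (J - p.+2%:R *: 1) - (c j)%:C *: 1).
Proof. by rewrite /Kseq -(scalemx1 _ p.+2%:R) -(scalemx1 _ (c j)%:C). Qed.

Lemma mpeval_Vpoly j x : mpeval (Vpoly j) x = L x * dg (delta j) * (L x)^t*.
Proof. by rewrite !mpevalM mpevalC mpeval_ctp (mpeval_Lpoly H alpha0). Qed.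

Let Y (x : R) : M := x%:C *: 1 - 2^-1 *: A.

Lemma mpeval_Phip j x :
  mpeval (Phip j) x = (d j)%:C *: J - (d j)%:C *: (A * Y x) + (c j)%:C *: 1.
Proof.
rewrite mpevalD mpevalM !mpevalC mpevalX /Y.
move: A J (d j)%:C (c j)%:C x%:C => A' J' dj cj y.
by rewrite !mxdistE; mxlin.
Qed.

Lemma mpeval_Psip j x :
  mpeval (Psip j) x = Y x * Kseq j + (B j - (d j)%:C *: A).
Proof.
rewrite mpevalD mpevalM !mpevalC mpevalX /Y.
move: A (Kseq j) (B j) (d j)%:C x%:C => A' K B' dj y.
by rewrite !mxdistE; mxlin.
Qed.

Let odeU x := @hermite_poly_ode R p H hH x.
Let BA j := Bmx_Aal alpha0 (d j).

Lemma Phip_Vpoly j : Phip j * Vpoly j = Vpoly j.+1.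
Proof.
apply: mpeval_inj => x; rewrite mpevalM !mpeval_Vpoly hDelta.
have : mpeval (Phip j) x * L x = L x * ((d j)%:C *: J + ((c j)%:C)%:M).
  rewrite mpeval_Phip (Lal_horner H alpha0) -(scalemx1 _ (c j)%:C).
  exact: (Phi_exp_shift _ _ (Aal_nilpotent alpha0) (Jmx_Aal alpha0) (odeU x) erefl).
move: (mpeval (Phip j) x) (_ + _) (L x) (dg _) => F S X D E.
by rewrite !mulrA E.
Qed.

Lemma Psip_Vpoly j : Psip j * Vpoly j = gaussderiv (Vpoly j.+1).
Proof.
apply: mpeval_inj => x; rewrite mpevalM mpeval_Vpoly.
have -> : mpeval (gaussderiv (Vpoly j.+1)) x =
    (A - (2 * x%:C) *: 1) * (L x * dg (delta j.+1) * (L x)^t*)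
     + L x * dg (delta j.+1) * A^t* * (L x)^t*.
  have ctLA : (A * L x)^t* = A^t* * (L x)^t*.
    have AL : A * L x = L x * A by rewrite (Lal_horner H alpha0); exact: comm_mx_horner.
    by rewrite AL ctM.
  rewrite /gaussderiv mpevalD mpevalN mulr2n mpevalD mpevalM mpevalX mpeval_Vpoly.
  rewrite /Vpoly !derivM derivC mulr0 addr0 (deriv_Lpoly hH alpha0) deriv_ctp.
  rewrite (deriv_Lpoly hH alpha0) mpevalD !mpevalM !mpeval_ctp !mpevalM !mpevalC.
  rewrite !(mpeval_Lpoly H alpha0) ctLA.
  exact: leibniz_arrange.
have : mpeval (Psip j) x * L x =
    (A - (2 * x%:C) *: 1) * (L x * ((d j)%:C *: J + ((c j)%:C)%:M)) + L x * B j.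
  rewrite mpeval_Psip KseqE (Lal_horner H alpha0) -(scalemx1 _ (c j)%:C).
  exact: (Psi_exp_shift _ (Aal_nilpotent alpha0) (Jmx_Aal alpha0) (BA j) (odeU x) erefl).
have := Delta_ctA j; rewrite hDelta.
move: (mpeval (Psip j) x) (_ + _) (A^t*) (B j) (L x) (dg _) (A - _) => F S Ac Bj X D G DA E.
rewrite -[X * (S * D) * Ac]mulrA DA.
by rewrite [F * _]mulrA [F * _]mulrA E !(mulrDl, mulrA).
Qed.

(** The recursion that the product rule and the Pearson equations impose on the
    polynomial R_n with [rodrigues_poly_Vpoly]. *)
Fixpoint rodrigues_poly n j : {poly M} :=
  if n is m.+1 then (rodrigues_poly m j.+1)^`() * Phip j + rodrigues_poly m j.+1 * Psip j else 1.

(** K_(j+n-1) ... K_j, the inverse of G_n at nu + j. *)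
Fixpoint Kprod j n : M := if n is m.+1 then Kprod j.+1 m * Kseq j else 1.

Lemma rodrigues_poly_Vpoly n j : rodrigues_poly n j * Vpoly j = iter n (@gaussderiv R p) (Vpoly (j + n)).
Proof.
elim: n j => [|n IH] j; first by rewrite mul1r addn0.
rewrite /= mulrDl -!mulrA Phip_Vpoly Psip_Vpoly -gaussderivMl IH.
by rewrite addSnnS.
Qed.

Lemma coef_mul_linear (Q : {poly M}) a b k :
  (Q * (a%:P * 'X + b%:P))`_k = (if k is m.+1 then Q`_m * a else 0) + Q`_k * b.
Proof.
rewrite mulrDr coefD mulrA coefMX !coefMC.
by case: k.
Qed.

Lemma coef_rodrigues_poly_gt n j k : (n < k)%N -> (rodrigues_poly n j)`_k = 0.
Proof.
elim: n j k => [|n IH] j [|k]//= nk; first by rewrite coef1.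
rewrite coefD /Phip /Psip !coef_mul_linear !coef_deriv !IH ?(ltnW nk)//.
  by rewrite !mul0rn !mul0r !addr0.
by rewrite ltnW// ltnW.
Qed.

(** In the recursion Phip multiplies a derivative, so only Psip reaches the top
    degree, with the leading coefficient of Psip. *)
Lemma coef_rodrigues_poly n j : (rodrigues_poly n j)`_n = Kprod j n.
Proof.
elim: n j => [|n IH] j /=; first by rewrite coef1.
rewrite coefD /Phip /Psip !coef_mul_linear !coef_deriv.
rewrite (@coef_rodrigues_poly_gt n j.+1 n.+1)// (@coef_rodrigues_poly_gt n j.+1 n.+2)//.
by rewrite !(mul0rn, mul0r, addr0, add0r) IH.
Qed.

Lemma size_rodrigues_poly n j : (size (rodrigues_poly n j) <= n.+1)%N.
Proof. by apply/leq_sizeP => k; exact: coef_rodrigues_poly_gt. Qed.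

Lemma gaussint_rodrigues_poly n j (Q : {poly M}) : (size Q <= n)%N -> gaussint (rodrigues_poly n j * Vpoly j * Q) = 0.
Proof. by move=> sQ; rewrite rodrigues_poly_Vpoly gaussint_iter_gaussderiv. Qed.


(** ** Conjugation of the leading coefficients by the exponential *)

Local Notation K := Kseq.
Local Notation E := (exp_Aal p alpha).

Lemma KseqD j : K j = dg (fun k => 2 * d j * k%:R + - (2 * (d j * p.+2%:R + c j))).
Proof.
rewrite dgmx_affine /Kseq !scalerBr !scalerA -addrA; congr (_ + _).
  by rewrite rmorphM /= (rmorph_nat (real_complex R) 2).
set b := - (2 * (d j * p.+2%:R + c j)).
rewrite -(scalemx1 _ p.+2%:R) -(scalemx1 _ (c j)%:C) -(scalemx1 _ b%:C).
rewrite !scalerA -!scaleNr -scalerDl /b; congr (_ *: _).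
have E2 : (2 * (d j * p.+2%:R + c j))%:C = 2 * ((d j)%:C * p.+2%:R + (c j)%:C).
  rewrite rmorphM /= (rmorph_nat (real_complex R) 2); congr (_ * _).
  by rewrite rmorphD rmorphM /= (rmorph_nat (real_complex R) p.+2).
by rewrite [RHS]rmorphN [in RHS]/= E2 /GRing.scale /=; ring.
Qed.

Lemma Kseq_unit j : K j \is a GRing.unit.
Proof.
rewrite KseqD; apply: (proj1 (dgmx_inv _)) => k /andP[k0 kp].
rewrite lt_eqF//; have := c_gt0 j; have : 0 <= d j * (p.+2%:R - k%:R).
  by rewrite mulr_ge0 ?(ltW (d_gt0 j))// subr_ge0 ler_nat ltnW.
by rewrite mulrBr; lra.
Qed.

(** The ratio of the alpha_k does not depend on nu.  Comparing its two expressions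
    at consecutive nu gives c_(j+1)/d_(j+1) = c_j/d_j + 1. *)
Lemma d_c_rec j k : (1 <= k <= p)%N -> d j * c j.+1 = d j * d j.+1 + d j.+1 * c j.
Proof.
move=> kp; have kp1 : (1 <= k <= p.+1)%N.
  by case/andP: kp => -> /= /leqW.
have kp2 : (1 <= k.+1 <= p.+1)%N by case/andP: kp.
have := halpha j.+1 kp; rewrite (halpha j kp) !deltaS//.
have d1 : delta j k != 0 by rewrite gt_eqF// delta_gt0.
have d2 : delta j k.+1 != 0 by rewrite gt_eqF// delta_gt0.
have e1 : d j * k%:R + c j != 0 by rewrite gt_eqF// affine_gt0.
have e2 : d j.+1 * k%:R + c j.+1 != 0 by rewrite gt_eqF// affine_gt0.
have k0 : k%:R != 0 :> R by rewrite pnatr_eq0 -lt0n; case/andP: kp.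
have k1 : p.+1%:R - k%:R != 0 :> R.
  by rewrite subr_eq0 eqr_nat gtn_eqF// ltnS; case/andP: kp.
rewrite -(natr1 k).
move: (k%:R) (p.+1%:R - k%:R) k0 k1 e1 e2 (delta j k) (delta j k.+1) d1 d2.
move=> x y x0 y0 e1 e2 a b a0 b0.
move=> /(congr1 (fun z => z * (2 * (d j.+1 * x + c j.+1) * (d j * x + c j) * a / b / x / y))).
set l := LHS; set r := RHS => lr.
have lE : l = d j * (d j.+1 * x + c j.+1) by rewrite /l; field; rewrite ?a0 ?b0 ?x0 ?y0 ?e1 ?e2.
have rE : r = d j.+1 * (d j * (x + 1) + c j) by rewrite /r; field; rewrite ?a0 ?b0 ?x0 ?y0 ?e1 ?e2.
move: lr; rewrite lE rE => lr; lra.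
Qed.

(** Moving A past a diagonal matrix shifts its entries by one place; for K_j this
    has the same effect, up to the factors d, as raising j. *)
Lemma Aal_Kseq j : (d j.+1)%:C *: (A * K j) = (d j)%:C *: (K j.+1 * A).
Proof.
apply/matrixP => i k; rewrite [LHS]mxE [RHS]mxE !KseqD mul_dgmx dgmx_mul (AalE alpha0).
case: eqP => [ik|_]; last by rewrite mul0r mulr0 !mulr0.
have kp : (1 <= k.+1 <= p)%N by have := ltn_ord i; rewrite ik ltnS => ->.
rewrite -!rmorphM /=; congr (_%:C).
have := d_c_rec j kp; rewrite ik -(natr1 k.+1).
move: (c j.+1) (2 * (_ / _)) (k.+1%:R) => cj y x E1.
apply/eqP; rewrite -subr_eq0; apply/eqP.
rewrite [LHS](_ : _ = 2 * y * (d j * cj - (d j * d j.+1 + d j.+1 * c j))); last by ring.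
by rewrite E1 subrr mulr0.
Qed.

Lemma KprodSr j n : Kprod j n.+1 = K (j + n) * Kprod j n.
Proof.
elim: n j => [|n IH] j; first by rewrite /= mul1r mulr1 addn0.
rewrite -[LHS]/(Kprod j.+1 n.+1 * K j) IH -[Kprod j n.+1]/(Kprod j.+1 n * K j).
by rewrite mulrA addSnnS.
Qed.

Lemma Kprod_unit j n : Kprod j n \is a GRing.unit.
Proof.
elim: n j => [|n IH] j /=; first exact: unitr1.
by rewrite unitrMl ?IH ?Kseq_unit.
Qed.

Lemma Aal_Kprod i m :
  (d (i + m))%:C *: (A * Kprod i m) = (d i)%:C *: (Kprod i.+1 m * A).
Proof.
elim: m => [|m IH]; first by rewrite addn0 mulr1 mul1r.
transitivity (K (i + m).+1 * ((d (i + m))%:C *: (A * Kprod i m))).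
  by rewrite KprodSr addnS mulrA scalerAl Aal_Kseq -scalerAl -scalerAr -mulrA.
by rewrite IH -scalerAr KprodSr mulrA addSn.
Qed.

Definition Mseq j n (t : R) : M := \sum_(k < n.+1)
  ('C(n, k)%:R * t ^+ k * \prod_(q < k) d (j + q))%:C *: (Kprod (j + k) (n - k) * A ^+ k).

(** Multiplying by K_(j+n) lengthens each product of K's, and multiplying by A,
    moved to the right by [Aal_Kprod], raises the power of A: the two halves of
    Pascal's rule. *)
Lemma MseqS j n t :
  Mseq j n.+1 t = (K (j + n) + (t * d (j + n))%:C *: A) * Mseq j n t.
Proof.
pose v k : M := (t ^+ k * \prod_(q < k) d (j + q))%:C *:
  (Kprod (j + k) (n.+1 - k) * A ^+ k).
have natC m (y : R) (X : M) : (m%:R * y)%:C *: X = (y%:C *: X) *+ m.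
  by rewrite rmorphM /= (rmorph_nat (real_complex R)) -scalerA scaler_nat.
have -> : Mseq j n.+1 t = \sum_(k < n.+2) v k *+ 'C(n.+1, k).
  by apply: eq_bigr => k _; rewrite -mulrA natC.
rewrite -pascal_sum mulrDl; apply/esym; congr (_ + _); rewrite mulr_sumr; apply: eq_bigr => k _.
  rewrite -(mulrA 'C(n, k)%:R) natC mulrnAr -scalerAr mulrA; congr (_ *: (_ * _) *+ _).
  by rewrite subSn -1?ltnS// KprodSr -addnA subnKC// -ltnS.
have kn : (k <= n)%N by rewrite -ltnS.
have := Aal_Kprod (j + k) (n - k); rewrite -addnA subnKC// => AK.
rewrite /v -natC big_ord_recr /= subSS addnS [A ^+ k.+1]exprS.
have -> : 'C(n, k)%:R * (t ^+ k.+1 * (\prod_(q < k) d (j + q) * d (j + k))) =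
   ('C(n, k)%:R * t ^+ k * \prod_(q < k) d (j + q)) * t * d (j + k) by rewrite exprS; ring.
rewrite [in RHS]rmorphM -[RHS]scalerA (mulrA _ A (A ^+ k)).
rewrite [X in _ = _ *: X]scalerAl -AK.
move: (\prod_(q < k) d (j + q)) (Kprod _ _) (A ^+ k) A => x Y' Z X.
rewrite -!scalerAl -!scalerAr !scalerA !mulrA -!rmorphM /=.
by congr (_%:C *: _); rewrite /GRing.scale /=; ring.
Qed.

Lemma Kseq_exp_Aal j s : K j * E s = E s * (K j + (2 * s * d j)%:C *: A).
Proof.
have JE := Jmx_exp_Aal alpha0 s.
rewrite /Kseq -(scalemx1 _ p.+2%:R) -(scalemx1 _ (c j)%:C).
have -> : (2 * s * d j)%:C = 2 * s%:C * (d j)%:C.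
  by rewrite !rmorphM /= (rmorph_nat (real_complex R) 2).
move: (E s) J A s%:C (d j)%:C (c j)%:C JE => X J' A' y dj cj JE.
by rewrite !mxdistE JE !mxdistE; mxlin.
Qed.

(** Conjugation by exp(s A) is multiplicative, and [MseqS] is the recursion
    satisfied by the product of the conjugates of the K_j. *)
Lemma Kprod_exp_Aal j n s : Kprod j n * E s = E s * Mseq j n (2 * s).
Proof.
elim: n => [|n IH].
  by rewrite /Mseq big_ord1 /= big_ord0 !mul1r expr0 scale1r mulr1.
by rewrite KprodSr -mulrA IH mulrA Kseq_exp_Aal MseqS !mulrA.
Qed.

Lemma MseqE j n s : Mseq j n (2 * s) = (E s)^-1 * Kprod j n * E s.
Proof. by rewrite -mulrA Kprod_exp_Aal mulKr// (exp_Aal_unit hH). Qed.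

Lemma Mseq_unit j n t : Mseq j n t \is a GRing.unit.
Proof.
have -> : t = 2 * (t / 2) by field.
by rewrite MseqE !unitrMl ?unitrV ?Kprod_unit ?(exp_Aal_unit hH).
Qed.


(** ** The shifted polynomials *)

Local Notation V := Vpoly.
Local Notation W := (fun j => weight p H alpha (fun _ => delta j) 0).

Lemma weightE j x : W j x = (expR (- x ^+ 2))%:C *: mpeval (V j) x.
Proof. by rewrite mpeval_Vpoly. Qed.

Lemma Vpoly_unit j x : mpeval (V j) x \is a GRing.unit.
Proof.
rewrite mpeval_Vpoly.
have Lu := Lal_unit hH alpha0 x.
have Du : dg (delta j) \is a GRing.unit.
  by apply: (proj1 (dgmx_inv _)) => k kp; rewrite gt_eqF// delta_gt0.
by rewrite unitrMl ?ct_unit// unitrMl.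
Qed.

Lemma Vpoly_ct j x : (mpeval (V j) x)^t* = mpeval (V j) x.
Proof.
rewrite mpeval_Vpoly; move: (L x) => X.
by rewrite ctM ctM ctK dgmx_ct mulrA.
Qed.

(** The Rodrigues formula: R_n is orthogonal to all polynomials of degree less
    than n since R_n times the weight is an n-th derivative. *)
Lemma mop_rodrigues j (P : nat -> {poly M}) n : is_mop (W j) P ->
  P n = ((Kprod j n)^-1)%:P * rodrigues_poly n j.
Proof.
move=> [P_monic P_orth].
have Ku := Kprod_unit j n.
apply: (@mop_unique _ _ L (V j) (delta j) (delta_gt0 j)) => //.
- by move=> x; exact: (Lal_unit hH alpha0).
- by move=> x; exact: mpeval_Vpoly.
- move=> k m km; rewrite -[RHS](P_orth k m km) -mintegral_gauss; congr mintegral.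
  apply/funext => x; rewrite weightE 2!mpevalM mpeval_ctp.
  by rewrite -scalerAr -scalerAl.
- apply/leq_sizeP => k nk; rewrite coefCM nth_default ?mulr0//.
  exact: leq_trans (size_rodrigues_poly _ _) nk.
- by rewrite coefCM coef_rodrigues_poly mulVr.
move=> D sD; rewrite -(mulrA _ (rodrigues_poly n j)) -(mulrA _ (rodrigues_poly n j * V j)) gaussintMl.
by rewrite gaussint_rodrigues_poly ?mulr0// (leq_trans (size_ctp _)).
Qed.

(** The product telescopes to W_0^-1 W_k, and the weights are self-adjoint. *)
Lemma prod_Phi_ct k x :
  (\prod_(j < k) ((W j x)^-1 * W j.+1 x))^t* =
  mpeval (V k) x * (mpeval (V 0%N) x)^-1.
Proof.
have Wu j : W j x \is a GRing.unit.
  rewrite weightE scaler_unit ?Vpoly_unit// unitfE.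
  by rewrite eq_complex /= eqxx andbT expR_eq0.
have -> : \prod_(j < k) ((W j x)^-1 * W j.+1 x) = (W 0%N x)^-1 * W k x.
  elim: k => [|k IH]; first by rewrite big_ord0 mulVr.
  by rewrite big_ord_recr /= IH mulrA mulrK.
rewrite ctM ctV// !weightE !ctZ !Vpoly_ct.
rewrite invrZ ?Vpoly_unit//; last first.
  by rewrite unitfE eq_complex /= eqxx andbT expR_eq0.
rewrite -scalerAr -scalerAl scalerA mulVf ?scale1r//.
by rewrite eq_complex /= eqxx andbT expR_eq0.
Qed.

Lemma transl_Vpoly s j : transl s (V j) = (E s)%:P * V j * ((E s)^t*)%:P.
Proof.
apply: mpeval_inj => x; rewrite mpeval_transl mpeval_Vpoly.
rewrite 2!mpevalM !mpevalC mpeval_Vpoly (Lal_shift hH alpha0).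
by move: (L x) => X; rewrite ctM !mulrA.
Qed.

(** The n-th derivative of the weight is translated in two ways: through the
    Rodrigues formula at index 0, and through the Leibniz expansion, each term of
    which is a Rodrigues formula at index k. *)
Lemma rodrigues_poly_shift n s x :
  mpeval (rodrigues_poly n 0) (x + s) * E s = E s * \sum_(k < n.+1)
    ('C(n, k)%:R * (- (2 * s)) ^+ k)%:C *:
      (mpeval (rodrigues_poly (n - k) k) x * (mpeval (V k) x * (mpeval (V 0%N) x)^-1)).
Proof.
have RV := rodrigues_poly_Vpoly.
have gdE m F : iter m (@gaussderiv R p) ((E s)%:P * F * ((E s)^t*)%:P) =
   (E s)%:P * iter m (@gaussderiv R p) F * ((E s)^t*)%:P.
  by elim: m => // m IH; rewrite !iterS IH gaussderivCM gaussderivMC.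
have Ecu : (E s)^t* \is a GRing.unit by rewrite ct_unit (exp_Aal_unit hH).
have VE : mpeval (V 0%N) (x + s) = E s * mpeval (V 0%N) x * (E s)^t*.
  by rewrite -mpeval_transl transl_Vpoly 2!mpevalM !mpevalC.
have termE k : (k <= n)%N ->
    mpeval (iter (n - k) (@gaussderiv R p) (transl s (V n))) x =
    E s * (mpeval (rodrigues_poly (n - k) k) x * mpeval (V k) x) * (E s)^t*.
  move=> kn; rewrite transl_Vpoly gdE -{2}(subnKC kn) -RV.
  by rewrite 2!mpevalM !mpevalC mpevalM.
have RV0 : rodrigues_poly n 0 * V 0%N = iter n (@gaussderiv R p) (V n) := RV n 0%N.
have E1 : mpeval (rodrigues_poly n 0) (x + s) * (E s * mpeval (V 0%N) x * (E s)^t*) =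
    mpeval (transl s (iter n (@gaussderiv R p) (V n))) x.
  by rewrite -VE -mpevalM RV0 mpeval_transl.
apply: (mulIr (Vpoly_unit 0 x)); apply: (mulIr Ecu).
rewrite -[LHS]mulrA -[LHS]mulrA (mulrA (E s)) E1 transl_iter_gaussderiv.
rewrite [mpeval (\sum_(_ < _) _) x]horner_sum mulr_sumr !mulr_suml; apply: eq_bigr => k _.
have kn : (k <= n)%N by rewrite -ltnS.
rewrite hornerMn hornerZ -/(mpeval _ x) termE// [_%:M * _]mul_scalar_mx.
rewrite -scaler_nat scalerA -(rmorph_nat (real_complex R)) -rmorphM /=.
rewrite -!(scalerAr, scalerAl); congr (_ *: _).
move: (E s) ((E s)^t*) (mpeval (rodrigues_poly _ _) x) (mpeval (V k) x) => X Xc F Z.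
have := Vpoly_unit 0 x; move: (mpeval (V 0%N) x) => T Tu.
by rewrite !mulrA mulrVK.
Qed.

Lemma Kprod_diag j n : exists f : nat -> R, Kprod j n = dg f.
Proof.
elim: n j => [|n IH] j; first by exists (fun=> 1); rewrite dgmx1.
by have [f fE] := IH j.+1; rewrite /= fE KseqD dgmxM; eexists.
Qed.

Lemma Mseq_trig n t : is_trig_mx (Mseq 0 n t).
Proof.
apply/is_trig_mxP => i j ij; rewrite summxE big1// => k _.
have [f ->] := Kprod_diag (0 + k) (n - k).
rewrite mxE dgmx_mul (Aal_expE alpha0); case: eqP => [E1|]; last by rewrite !mulr0.
by move: ij; rewrite E1 ltnNge leq_addr.
Qed.

Lemma shift_formula (P : nat -> nat -> {poly M}) n s x :
  (forall j, is_mop (W j) (P j)) ->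
  E (- s) * mpeval (P 0%N n) (x + s) * E s =
  (Mseq 0 n (2 * s))^-1 * \sum_(k < n.+1)
    ('C(n, k)%:R * (- (2 * s)) ^+ k)%:C *:
      (Kprod k (n - k) * mpeval (P k (n - k)%N) x *
       (\prod_(j < k) ((W j x)^-1 * W j.+1 x))^t*).
Proof.
move=> hP; have Eu := exp_Aal_unit hH alpha0 s.
rewrite (mop_rodrigues _ (hP 0%N)) mpevalM mpevalC -!mulrA rodrigues_poly_shift.
rewrite MseqE.
have Ku := Kprod_unit 0 n.
rewrite [X in _ = X * _]invrM ?unitrMl ?unitrV// [X in _ = (_ * X) * _]invrM ?unitrV// invrK.
rewrite (exp_AalV hH alpha0) -!mulrA; congr (_ * (_ * (_ * _))).
apply: eq_bigr => k _; congr (_ *: _).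
rewrite (mop_rodrigues _ (hP k)) (mpevalM _%:P) mpevalC prod_Phi_ct.
by rewrite mulVKr ?Kprod_unit.
Qed.

End Rodrigues.

(** * The expansion of the shifted polynomials *)

Theorem proposition5p2 (R : realType) (p : nat) (H : nat -> {poly R})
    (alpha : nat -> R) (nu0 : R) (delta : R -> nat -> R) (c d : R -> R)
    (P : R -> nat -> {poly 'M[R[i]]_p.+1})
    (hH : is_hermite H)
    (halpha : forall k, (1 <= k <= p.+1)%N -> alpha k != 0)
    (halpha1 : alpha 1%N = 1)
    (hstanding : standing p alpha nu0 delta c d)
    (hP : forall nu, nu_range nu0 nu ->
       is_mop (weight p H alpha delta nu) (P nu))
    (nu : R) (hnu : nu_range nu0 nu) (n : nat) (t : R) :
  [/\ Mmx p alpha c d nu n t \in unitmx,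
      is_trig_mx (Mmx p alpha c d nu n t)
    & forall x : R,
        mexp (- (t / 2)%:C *: Aal p alpha)
          * mpeval (P nu n) (x + t / 2)
          * mexp ((t / 2)%:C *: Aal p alpha)
        = (Mmx p alpha c d nu n t)^-1
          * \sum_(k < n.+1)
              (('C(n, k)%:R * (- t) ^+ k)%:C
                 *: ((Gmx p c d (nu + k%:R) (n - k))^-1
                     * mpeval (P (nu + k%:R) (n - k)%N) x
                     * (\prod_(j < k) Phi p H alpha delta (nu + j%:R) x)^t*))].
Proof.
pose deltas j := delta (nu + j%:R).
pose cs j := c (nu + j%:R); pose ds j := d (nu + j%:R).
have natS j : nu + j.+1%:R = nu + j%:R + 1 by rewrite -addrA natr1.
(* From here on everything is indexed by j, standing for nu + j. *)
have range j : nu_range nu0 (nu + j%:R).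
  by have [i ->] := hnu; exists (i + j)%N; rewrite natrD addrA.
have std j := hstanding _ (range j).
have delta_gt0 j k : (1 <= k <= p.+1)%N -> 0 < deltas j k by have [+ _ _ _ _] := std j; apply.
have c_gt0 j : 0 < cs j by have [] := std j.
have d_gt0 j : 0 < ds j by have [] := std j.
have hDelta j : dgmx p (deltas j.+1) =
    ((ds j)%:C *: Jmx R p + ((cs j)%:C)%:M) * dgmx p (deltas j).
  by rewrite /deltas natS; have [] := std j.
have hratio j k : (1 <= k <= p)%N -> alpha k.+1 ^+ 2 / alpha k ^+ 2 =
    ds j * k%:R * (p.+1%:R - k%:R) / (2 * (ds j * k%:R + cs j)) *
    (deltas j k.+1 / deltas j k).
  by have [_ _ _ _] := std j; apply.
have GE k m : (Gmx p c d (nu + k%:R) m)^-1 = Kprod p cs ds k m.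
  elim: m => [|m IH]; first by rewrite /Gmx big_ord0 invr1.
  have KE : Kmx p c d (nu + k%:R + m%:R) = Kseq p cs ds (k + m).
    by rewrite -addrA -natrD.
  have Ku := Kseq_unit p c_gt0 d_gt0 (k + m).
  have Gu : Gmx p c d (nu + k%:R) m \is a GRing.unit.
    by rewrite -unitrV IH Kprod_unit.
  by rewrite KprodSr -IH /Gmx big_ord_recr /= KE invrM ?unitrV// invrK.
have ME : Mmx p alpha c d nu n t = Mseq p alpha cs ds 0 n t.
  by apply: eq_bigr => k _; rewrite GE.
rewrite ME; split; [exact: (Mseq_unit hH halpha delta_gt0 c_gt0 d_gt0 hDelta hratio)
  |exact: Mseq_trig|].
move=> x; rewrite -rmorphN !(mexp_Aal halpha).
have := shift_formula hH halpha delta_gt0 c_gt0 d_gt0 hDelta hratio n (t / 2) x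
  (fun j => hP _ (range j)).
have -> : 2 * (t / 2) = t by field.
have -> : nu + 0%:R = nu by rewrite addr0.
move=> shiftE; apply: (etrans shiftE).
apply: (congr1 (fun S : 'M[R[i]]_(p.+1) => _ * S)).
apply: eq_bigr => k _.
rewrite GE.
apply: (congr1 (fun S : 'M[R[i]]_(p.+1) => _ *: (_ * S^t*))).
apply: eq_bigr => j _.
by rewrite /Phi -natS.
Qed.
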